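(* Let $H$ be a Hilbert module over a $C^*$-algebra. For every idempotent $Q\in\mathcal{L}(H)$, with matched projection $m(Q)$, we have $$m(Q)=\tfrac12\big(|Q^*|+Q^*\big)|Q^*|^\dag\big(|Q^*|+I\big)^{-1}\big(|Q^*|+Q\big),$$ where $|Q^*|^\dag$ denotes the Moore-Penrose inverse of $|Q^*|$, which can be formulated by $$|Q^*|^\dag=\left(P_{\mathcal{R}(Q)}P_{\mathcal{R}(Q^* )}P_{\mathcal{R}(Q)}\right)^{\frac12}.$$
   Context: $\mathcal{L}(H)$ is the $C^*$-algebra of adjointable operators on the Hilbert $C^*$-module $H$, and $I$ is the identity operator on $H$. $\mathcal{R}(\cdot)$ and $\mathcal{N}(\cdot)$ denote range and null space. An idempotent is $Q\in\mathcal{L}(H)$ with $Q^2=Q$; a projection is a self-adjoint idempotent. For an orthogonally complemented closed submodule $M$ of $H$, $P_M$ is the projection of $H$ onto $M$ (ranges of idempotents are orthogonally complemented). $|T|=(T^*T)^{1/2}$, so $|Q^*|=(QQ^* )^{1/2}$. The Moore-Penrose inverse of $T$, when it exists, is the unique adjointable operator $T^\dag$ with $TT^\dag T=T$, $T^\dag TT^\dag=T^\dag$, $(TT^\dag)^*=TT^\dag$, $(T^\dag T)^*=T^\dag T$. Definition of the matched projection $m(Q)$ of an idempotent $Q\in\mathcal{L}(H)$: if $Q$ is a projection, $m(Q)=Q$. Otherwise, $H=\mathcal{R}(Q)\dotplus\mathcal{N}(Q^* )$ is an orthogonal decomposition; let $U:H\to\mathcal{R}(Q)\oplus\mathcal{N}(Q^*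 )$ be the unitary $Uh=\binom{P_{\mathcal{R}(Q)}h}{(I-P_{\mathcal{R}(Q)})h}$, let $I_1$ be the identity on $\mathcal{R}(Q)$, let $A=(Q-P_{\mathcal{R}(Q)})|_{\mathcal{N}(Q^* )}:\mathcal{N}(Q^* )\to\mathcal{R}(Q)$ and $B=(AA^*+I_1)^{1/2}$, and set $$m(Q)=U^*\cdot\frac12\begin{pmatrix}(B+I_1)B^{-1} & B^{-1}A\\ A^*B^{-1} & A^*[B(B+I_1)]^{-1}A\end{pmatrix}\cdot U .$$ *)

(* Defs.v *)
From HB Require Import structures.
From mathcomp Require Import all_boot all_order all_algebra.
From mathcomp Require Import complex.
From mathcomp Require Import all_classical all_reals.
From mathcomp Require Import topology normedtype.

Set Implicit Arguments.
Unset Strict Implicit.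
Unset Printing Implicit Defensive.

Import Order.TTheory GRing.Theory Num.Theory.
Import numFieldNormedType.Exports.

Local Open Scope classical_set_scope.
Local Open Scope ring_scope.

(* Complex C*-algebras, not assumed unital: MathComp rings all have a unit,
   hence the separate multiplication [cmul].  The norm is the R[i]-valued norm
   of the underlying Banach space. *)
HB.mixin Record CompleteNormedModule_isCStarAlgebra (R : realType) A
    of CompleteNormedModule R[i] A := {
  cmul : A -> A -> A;
  cstar : A -> A;
  cmulA : associative cmul;
  cmulDl : left_distributive cmul +%R;
  cmulDr : right_distributive cmul +%R;
  cmulZl : forall (k : R[i]) a b, cmul (k *: a) b = k *: cmul a b;
  cmulZr : forall (k : R[i]) a b, cmul a (k *: b) = k *: cmul a b;
  cstarK : involutive cstar;
  cstarD : {morph cstar : a b / a + b};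
  cstarZ : forall (k : R[i]) a, cstar (k *: a) = Num.conj k *: cstar a;
  cstarM : forall a b, cstar (cmul a b) = cmul (cstar b) (cstar a);
  cnormM_le : forall a b, `|cmul a b| <= `|a| * `|b|;
  cnorm_star : forall a, `|cmul (cstar a) a| = `|a| ^+ 2 }.

#[short(type="cstarAlgType")]
HB.structure Definition CStarAlgebra (R : realType) :=
  { A of CompleteNormedModule R[i] A
    & CompleteNormedModule_isCStarAlgebra R A }.

(* In the unitization, [1 - a] is invertible with inverse [1 - b]. *)
Definition quasi_invertible (R : realType) (A : cstarAlgType R) (a : A) :
    Prop :=
  exists b : A, a + b = cmul a b /\ a + b = cmul b a.

(* The spectrum computed in the unitization.  It always contains 0; if A is
   unital it differs from the usual spectrum at most by 0, which does not affect
   [cpositive]. *)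
Definition spectrum (R : realType) (A : cstarAlgType R) (a : A) : set R[i] :=
  [set k | k = 0 \/ ~ quasi_invertible (k^-1 *: a)].

(* [0 <= k] on R[i] means that k is a nonnegative real. *)
Definition cpositive (R : realType) (A : cstarAlgType R) (a : A) : Prop :=
  cstar a = a /\ (forall k, spectrum a k -> 0 <= k).

(* Right A-modules with an A-valued Hermitian form, linear in the second
   variable.  Definiteness and completeness are only required in
   [hilbertModType] below; adjoints, square roots and inverses of operators on
   submodules and direct sums depend on the form alone, so these only get the
   present structure. *)
HB.mixin Record Lmodule_isInnerModule (R : realType) (A : cstarAlgType R) E
    of GRing.Lmodule R[i] E := {
  ract : E -> A -> E;
  inner : E -> E -> A;
  ractM : forall x a b, ract x (cmul a b) = ract (ract x a) b;
  ractDl : forall x y a, ract (x + y) a = ract x a + ract y a;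
  ractDr : forall x a b, ract x (a + b) = ract x a + ract x b;
  ractZl : forall (k : R[i]) x a, ract (k *: x) a = k *: ract x a;
  ractZr : forall (k : R[i]) x a, ract x (k *: a) = k *: ract x a;
  innerDr : forall x y z, inner x (y + z) = inner x y + inner x z;
  innerZr : forall (k : R[i]) x y, inner x (k *: y) = k *: inner x y;
  innerAr : forall x y a, inner x (ract y a) = cmul (inner x y) a;
  inner_star : forall x y, cstar (inner x y) = inner y x }.

#[short(type="innerModType")]
HB.structure Definition InnerModule (R : realType) (A : cstarAlgType R) :=
  { E of GRing.Lmodule R[i] E & Lmodule_isInnerModule R A E }.

HB.mixin Record InnerModule_isHilbert (R : realType) (A : cstarAlgType R) H
    of InnerModule R A H & CompleteNormedModule R[i] H := {
  inner_ge0 : forall x : H, cpositive (inner x x : A);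
  inner_eq0 : forall x : H, (inner x x : A) = 0 -> x = 0;
  hnormE : forall x : H, `|x| = sqrtC `|(inner x x : A)| }.

#[short(type="hilbertModType")]
HB.structure Definition HilbertModule (R : realType) (A : cstarAlgType R) :=
  { H of InnerModule R A H & CompleteNormedModule R[i] H
    & InnerModule_isHilbert R A H }.

Section InnerTheory.
Context {R : realType} {A : cstarAlgType R}.
Implicit Types (E : innerModType A) (H : hilbertModType A).

Lemma ract0l E (a : A) : ract (0 : E) a = 0.
Proof. by rewrite -[X in ract X](scale0r (0 : E)) ractZl scale0r. Qed.

Lemma cstarN (a : A) : cstar (- a) = - cstar a.
Proof. by rewrite -scaleN1r cstarZ rmorphN rmorph1 scaleN1r. Qed.

Lemma innerDl E (x y z : E) : inner (x + y) z = inner x z + inner y z.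
Proof. by rewrite -inner_star innerDr cstarD !inner_star. Qed.

Lemma innerZl E (k : R[i]) (x y : E) :
  inner (k *: x) y = Num.conj k *: inner x y.
Proof. by rewrite -inner_star innerZr cstarZ inner_star. Qed.

Lemma innerAl E (x y : E) (a : A) :
  inner (ract x a) y = cmul (cstar a) (inner x y).
Proof. by rewrite -inner_star innerAr cstarM inner_star. Qed.

Lemma inner0r E (x : E) : inner x 0 = 0.
Proof. by rewrite -(scale0r 0) innerZr scale0r. Qed.

Lemma inner0l E (x : E) : inner 0 x = 0.
Proof. by rewrite -(scale0r 0) innerZl rmorph0 scale0r. Qed.

Lemma innerNr E (x y : E) : inner x (- y) = - inner x y.
Proof. by rewrite -scaleN1r innerZr scaleN1r. Qed.

Lemma innerNl E (x y : E) : inner (- x) y = - inner x y.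
Proof. by rewrite -inner_star innerNr cstarN inner_star. Qed.

Lemma inner_inj H (x y : H) : (forall z : H, inner x z = inner y z) -> x = y.
Proof.
move=> xy; apply/eqP; rewrite -subr_eq0; apply/eqP/inner_eq0.
by rewrite innerDl innerNl xy subrr.
Qed.

End InnerTheory.

Definition adjoint_of (R : realType) (A : cstarAlgType R)
    (E F : innerModType A) (T : E -> F) (S : F -> E) : Prop :=
  forall x y, inner (T x) y = inner x (S y).

Record adjop (R : realType) (A : cstarAlgType R) (E F : innerModType A) :=
  AdjOp { adjop_fun :> E -> F;
          adjopP : exists S : F -> E, adjoint_of adjop_fun S }.

Notation "''L' ( E , F )" := (adjop E F)
  (at level 8, format "''L' ( E ,  F )") : type_scope.
Notation "''L' ( E )" := (adjop E E)
  (at level 8, format "''L' ( E )") : type_scope.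

Section AdjOp.
Context {R : realType} {A : cstarAlgType R}.
Implicit Types E F G : innerModType A.

Lemma adjop_ext E F (S T : 'L(E, F)) : S =1 T -> S = T.
Proof.
case: S T => [s sP] [t tP] /= /funext st; case: _ / st in tP *.
by congr AdjOp; exact: Prop_irrelevance.
Qed.

HB.instance Definition _ E F := gen_eqMixin 'L(E, F).
HB.instance Definition _ E F := gen_choiceMixin 'L(E, F).

Fact zeroL_subproof E F : exists S : F -> E, adjoint_of (fun _ : E => 0) S.
Proof. by exists (fun=> 0) => x y; rewrite inner0l inner0r. Qed.
Definition zeroL E F : 'L(E, F) := AdjOp (zeroL_subproof E F).

Fact oppL_subproof E F (T : 'L(E, F)) :
  exists S : F -> E, adjoint_of (fun x => - T x) S.
Proof.
have [S TS] := adjopP T.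
by exists (fun y => - S y) => x y; rewrite innerNl innerNr TS.
Qed.
Definition oppL E F (T : 'L(E, F)) : 'L(E, F) := AdjOp (oppL_subproof T).

Fact addL_subproof E F (T1 T2 : 'L(E, F)) :
  exists S : F -> E, adjoint_of (fun x => T1 x + T2 x) S.
Proof.
have [S1 TS1] := adjopP T1; have [S2 TS2] := adjopP T2.
by exists (fun y => S1 y + S2 y) => x y; rewrite innerDl innerDr TS1 TS2.
Qed.
Definition addL E F (T1 T2 : 'L(E, F)) : 'L(E, F) :=
  AdjOp (addL_subproof T1 T2).

Fact scaleL_subproof E F (k : R[i]) (T : 'L(E, F)) :
  exists S : F -> E, adjoint_of (fun x => k *: T x) S.
Proof.
have [S TS] := adjopP T.
by exists (fun y => Num.conj k *: S y) => x y; rewrite innerZl innerZr TS.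
Qed.
Definition scaleL E F (k : R[i]) (T : 'L(E, F)) : 'L(E, F) :=
  AdjOp (scaleL_subproof k T).

Fact addLA E F : associative (@addL E F).
Proof. by move=> S T U; apply: adjop_ext => x /=; rewrite addrA. Qed.
Fact addLC E F : commutative (@addL E F).
Proof. by move=> S T; apply: adjop_ext => x /=; rewrite addrC. Qed.
Fact add0L E F : left_id (zeroL E F) (@addL E F).
Proof. by move=> T; apply: adjop_ext => x /=; rewrite add0r. Qed.
Fact addNL E F : left_inverse (zeroL E F) (@oppL E F) (@addL E F).
Proof. by move=> T; apply: adjop_ext => x /=; rewrite addNr. Qed.

HB.instance Definition _ E F := GRing.isZmodule.Build 'L(E, F)
  (@addLA E F) (@addLC E F) (@add0L E F) (@addNL E F).

Fact scaleLA E F k l (T : 'L(E, F)) :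
  scaleL k (scaleL l T) = scaleL (k * l) T.
Proof. by apply: adjop_ext => x /=; rewrite scalerA. Qed.
Fact scale1L E F : left_id 1 (@scaleL E F).
Proof. by move=> T; apply: adjop_ext => x /=; rewrite scale1r. Qed.
Fact scaleLDr E F : right_distributive (@scaleL E F) +%R.
Proof. by move=> k S T; apply: adjop_ext => x /=; rewrite scalerDr. Qed.
Fact scaleLDl E F (T : 'L(E, F)) : {morph (@scaleL E F)^~ T : k l / k + l}.
Proof. by move=> k l; apply: adjop_ext => x /=; rewrite scalerDl. Qed.

HB.instance Definition _ E F := GRing.Zmodule_isLmodule.Build R[i] 'L(E, F)
  (@scaleLA E F) (@scale1L E F) (@scaleLDr E F) (@scaleLDl E F).

Fact idL_subproof E : exists S : E -> E, adjoint_of (fun x : E => x) S.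
Proof. by exists id. Qed.
Definition idL E : 'L(E) := AdjOp (idL_subproof E).

Fact compL_subproof E F G (S : 'L(F, G)) (T : 'L(E, F)) :
  exists U : G -> E, adjoint_of (fun x => S (T x)) U.
Proof.
have [S' SS'] := adjopP S; have [T' TT'] := adjopP T.
by exists (fun z => T' (S' z)) => x y; rewrite SS' TT'.
Qed.
Definition compL E F G (S : 'L(F, G)) (T : 'L(E, F)) : 'L(E, G) :=
  AdjOp (compL_subproof S T).

(* The operator with property P; 0 if there is none. *)
Definition the_op E F (P : set 'L(E, F)) : 'L(E, F) := xget 0 P.

Definition adj E F (T : 'L(E, F)) : 'L(F, E) :=
  the_op [set S | adjoint_of T S].

Lemma adjP E F (T : 'L(E, F)) : adjoint_of T (adj T).
Proof.
have [S TS] := adjopP T.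
have SP : exists U : E -> F, adjoint_of S U.
  by exists T => y x; rewrite -inner_star -TS inner_star.
exact: (@xgetPex _ 0 [set U : 'L(F, E) | adjoint_of T U]
  (ex_intro _ (AdjOp SP) TS)).
Qed.

End AdjOp.

Arguments idL {R A E}.
Notation "S \oL T" := (compL S T)
  (at level 40, left associativity, format "S  \oL  T") : ring_scope.

Section OperatorTheory.
Context {R : realType} {A : cstarAlgType R}.
Implicit Types E F : innerModType A.

Definition idempotentL E (Q : 'L(E)) : Prop := Q \oL Q = Q.

Definition projectionL E (P : 'L(E)) : Prop := idempotentL P /\ adj P = P.

(* On a Hilbert module this is positivity in the C*-algebra L(E); in particular
   such a T is self-adjoint, by polarization. *)
Definition positiveL E (T : 'L(E)) : Prop :=
  forall x : E, cpositive (inner x (T x) : A).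

Definition sqrtL E (T : 'L(E)) : 'L(E) :=
  the_op [set S | positiveL S /\ S \oL S = T].

Definition absL E F (T : 'L(E, F)) : 'L(E) := sqrtL (adj T \oL T).

Definition invL E F (T : 'L(E, F)) : 'L(F, E) :=
  the_op [set S | S \oL T = idL /\ T \oL S = idL].

Definition moore_penrose E F (T : 'L(E, F)) (X : 'L(F, E)) : Prop :=
  [/\ T \oL X \oL T = T, X \oL T \oL X = X,
      adj (T \oL X) = T \oL X & adj (X \oL T) = X \oL T].

Definition pinvL E F (T : 'L(E, F)) : 'L(F, E) := the_op (moore_penrose T).

End OperatorTheory.

Record submod (R : realType) (A : cstarAlgType R) (E : innerModType A) :=
  Submod {
    submod_set : set E;
    submod0 : submod_set 0;
    submodD : forall x y, submod_set x -> submod_set y -> submod_set (x + y);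
    submodZ : forall (k : R[i]) x, submod_set x -> submod_set (k *: x);
    submodA : forall x (a : A), submod_set x -> submod_set (ract x a) }.

Section SubmodType.
Context {R : realType} {A : cstarAlgType R} {E : innerModType A}.
Variable M : submod E.

Definition submod_pred : {pred E} := fun x => x \in submod_set M.

Fact submod_pred_closed : submod_closed submod_pred.
Proof.
split=> [|k x y]; rewrite !unfold_in ?inE; first exact: submod0.
by move=> Mx My; apply: submodD => //; apply: submodZ.
Qed.

HB.instance Definition _ :=
  GRing.isSubmodClosed.Build R[i] E submod_pred submod_pred_closed.

Record submod_type := SubmodElt {
  submod_val : E; submod_valP : submod_val \in submod_pred }.

HB.instance Definition _ := [isSub for submod_val].
HB.instance Definition _ := [Choice of submod_type by <:].
HB.instance Definition _ := [SubChoice_isSubLmodule of submod_type by <:].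

Fact submod_ract_subproof (x : submod_type) (a : A) :
  ract (submod_val x) a \in submod_pred.
Proof.
case: x => x /=; rewrite !unfold_in !inE; exact: submodA.
Qed.

Definition submod_ract (x : submod_type) (a : A) : submod_type :=
  SubmodElt (submod_ract_subproof x a).

Definition submod_inner (x y : submod_type) : A :=
  inner (submod_val x) (submod_val y).

Fact submod_ractM x a b :
  submod_ract x (cmul a b) = submod_ract (submod_ract x a) b.
Proof. by apply: val_inj; rewrite /= ractM. Qed.
Fact submod_ractDl x y a :
  submod_ract (x + y) a = submod_ract x a + submod_ract y a.
Proof. by apply: val_inj; rewrite /= ractDl. Qed.
Fact submod_ractDr x a b :
  submod_ract x (a + b) = submod_ract x a + submod_ract x b.
Proof. by apply: val_inj; rewrite /= ractDr. Qed.
Fact submod_ractZl (k : R[i]) x a :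
  submod_ract (k *: x) a = k *: submod_ract x a.
Proof. by apply: val_inj; rewrite /= ractZl. Qed.
Fact submod_ractZr (k : R[i]) x a :
  submod_ract x (k *: a) = k *: submod_ract x a.
Proof. by apply: val_inj; rewrite /= ractZr. Qed.
Fact submod_innerDr x y z :
  submod_inner x (y + z) = submod_inner x y + submod_inner x z.
Proof. exact: innerDr. Qed.
Fact submod_innerZr (k : R[i]) x y :
  submod_inner x (k *: y) = k *: submod_inner x y.
Proof. exact: innerZr. Qed.
Fact submod_innerAr x y a :
  submod_inner x (submod_ract y a) = cmul (submod_inner x y) a.
Proof. exact: innerAr. Qed.
Fact submod_inner_star x y : cstar (submod_inner x y) = submod_inner y x.
Proof. exact: inner_star. Qed.

HB.instance Definition _ := Lmodule_isInnerModule.Build R A submod_type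
  submod_ractM submod_ractDl submod_ractDr submod_ractZl submod_ractZr
  submod_innerDr submod_innerZr submod_innerAr submod_inner_star.

End SubmodType.

Coercion submod_type : submod >-> Sortclass.

Section DirectSum.
Context {R : realType} {A : cstarAlgType R} (E F : innerModType A).

Definition dsum := (E * F)%type.
HB.instance Definition _ := GRing.Lmodule.on dsum.

Definition dsum_ract (z : dsum) (a : A) : dsum := (ract z.1 a, ract z.2 a).
Definition dsum_inner (z w : dsum) : A := inner z.1 w.1 + inner z.2 w.2.

Fact dsum_ractM z a b : dsum_ract z (cmul a b) = dsum_ract (dsum_ract z a) b.
Proof. by congr pair; rewrite ractM. Qed.
Fact dsum_ractDl z w a : dsum_ract (z + w) a = dsum_ract z a + dsum_ract w a.
Proof. by congr pair; rewrite ractDl. Qed.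
Fact dsum_ractDr z a b : dsum_ract z (a + b) = dsum_ract z a + dsum_ract z b.
Proof. by congr pair; rewrite ractDr. Qed.
Fact dsum_ractZl (k : R[i]) z a : dsum_ract (k *: z) a = k *: dsum_ract z a.
Proof. by congr pair; rewrite ractZl. Qed.
Fact dsum_ractZr (k : R[i]) z a : dsum_ract z (k *: a) = k *: dsum_ract z a.
Proof. by congr pair; rewrite ractZr. Qed.
Fact dsum_innerDr x y z :
  dsum_inner x (y + z) = dsum_inner x y + dsum_inner x z.
Proof. by rewrite /dsum_inner !innerDr addrACA. Qed.
Fact dsum_innerZr (k : R[i]) x y :
  dsum_inner x (k *: y) = k *: dsum_inner x y.
Proof. by rewrite /dsum_inner !innerZr scalerDr. Qed.
Fact dsum_innerAr x y a :
  dsum_inner x (dsum_ract y a) = cmul (dsum_inner x y) a.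
Proof. by rewrite /dsum_inner !innerAr cmulDl. Qed.
Fact dsum_inner_star x y : cstar (dsum_inner x y) = dsum_inner y x.
Proof. by rewrite /dsum_inner cstarD !inner_star. Qed.

HB.instance Definition _ := Lmodule_isInnerModule.Build R A dsum
  dsum_ractM dsum_ractDl dsum_ractDr dsum_ractZl dsum_ractZr
  dsum_innerDr dsum_innerZr dsum_innerAr dsum_inner_star.

Fact blockL_subproof (T11 : 'L(E)) (T12 : 'L(F, E)) (T21 : 'L(E, F))
    (T22 : 'L(F)) : exists S : dsum -> dsum,
  adjoint_of (fun z : dsum => (T11 z.1 + T12 z.2, T21 z.1 + T22 z.2) : dsum) S.
Proof.
have [S11 P11] := adjopP T11; have [S12 P12] := adjopP T12.
have [S21 P21] := adjopP T21; have [S22 P22] := adjopP T22.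
exists (fun w : dsum => (S11 w.1 + S21 w.2, S12 w.1 + S22 w.2)) => z w.
rewrite /inner /= /dsum_inner /= !innerDl !innerDr P11 P12 P21 P22.
by rewrite addrACA.
Qed.

Definition blockL T11 T12 T21 T22 : 'L(dsum) :=
  AdjOp (blockL_subproof T11 T12 T21 T22).

End DirectSum.

Section MatchedProjection.
Context {R : realType} {A : cstarAlgType R}.
Implicit Types H K : hilbertModType A.

Lemma adjopD H K (T : 'L(H, K)) (x y : H) : T (x + y) = T x + T y.
Proof.
have [S TS] := adjopP T.
by apply: inner_inj => z; rewrite innerDl !TS innerDl.
Qed.

Lemma adjopZ H K (T : 'L(H, K)) (k : R[i]) (x : H) : T (k *: x) = k *: T x.
Proof.
have [S TS] := adjopP T.
by apply: inner_inj => z; rewrite innerZl !TS innerZl.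
Qed.

Lemma adjopA H K (T : 'L(H, K)) (x : H) (a : A) :
  T (ract x a) = ract (T x) a.
Proof.
have [S TS] := adjopP T.
by apply: inner_inj => z; rewrite innerAl !TS innerAl.
Qed.

Lemma adjop0 H K (T : 'L(H, K)) : T 0 = 0.
Proof. by rewrite -(scale0r 0) adjopZ scale0r. Qed.

Definition rangeL H K (T : 'L(H, K)) : submod K.
Proof.
apply: (@Submod R A K (range T)).
- by exists 0; [|exact: adjop0].
- by move=> _ _ [x _ <-] [y _ <-]; exists (x + y); [|exact: adjopD].
- by move=> k _ [x _ <-]; exists (k *: x); [|exact: adjopZ].
- by move=> _ a [x _ <-]; exists (ract x a); [|exact: adjopA].
Defined.

Definition nullL H K (T : 'L(H, K)) : submod H.
Proof.
apply: (@Submod R A H [set x | T x = 0]).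
- exact: adjop0.
- by move=> x y /= Tx Ty; rewrite adjopD Tx Ty addr0.
- by move=> k x /= Tx; rewrite adjopZ Tx scaler0.
- by move=> x a /= Tx; rewrite adjopA Tx ract0l.
Defined.

(* Meaningful for M orthogonally complemented. *)
Definition projL H (M : submod H) : 'L(H) :=
  the_op [set P | projectionL P /\ range P = submod_set M].

(* [T|_M] viewed as an operator from M to N, for T mapping M into N. *)
Definition restrictL H (M N : submod H) (T : 'L(H)) : 'L(M, N) :=
  the_op [set S : 'L(M, N) | forall x : M, submod_val (S x) = T (submod_val x)].

Section Matched.
Variables (H : hilbertModType A) (Q : 'L(H)).
Local Notation P := (projL (rangeL Q)).
Local Notation M := (rangeL Q).
Local Notation N := (nullL (adj Q)).

Definition matchedU : 'L(H, dsum M N) :=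
  the_op [set U : 'L(H, dsum M N) | forall h,
    submod_val (U h).1 = P h /\ submod_val (U h).2 = (idL - P) h].

Definition matchedA : 'L(N, M) := restrictL N M (Q - P).

Definition matchedB : 'L(M) := sqrtL (matchedA \oL adj matchedA + idL).

Definition matched_block : 'L(dsum M N) :=
  let a := matchedA in
  let b := matchedB in
  blockL ((b + idL) \oL invL b)
         (invL b \oL a)
         (adj a \oL invL b)
         (adj a \oL invL (b \oL (b + idL)) \oL a).

Definition matched_proj : 'L(H) :=
  if `[< projectionL Q >] then Q
  else adj matchedU \oL (2^-1 *: matched_block) \oL matchedU.

End Matched.
End MatchedProjection.

(* Main.v *)
(* Let W = Q + Q^* - 1.  Then W^2 = 1 + K^2 with K = i Q - i Q^* self-adjoint, so
   W^2 is invertible; it commutes with Q and Q^*, and P = Q Q^* W^-2 and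
   P' = Q^* Q W^-2 are the projections onto the ranges of Q and Q^*, with
   Q Q^* = W^2 P and P P' P = W^-2 P.  Hence, for the positive square root S of
   W^2, |Q^*| = S P, |Q^*|^+ = S^-1 P = (P P' P)^(1/2), and the operator B in the
   definition of m(Q) is the restriction of S to the range of Q; the formula
   becomes an identity in the algebra generated by Q, Q^* and S.

   Square roots come from the C*-identity.  If X is self-adjoint and |X| < 1, the
   iteration Y := (X + Y^2) / 2 converges to a solution of (1 - Y)^2 = 1 - X.  For
   commuting self-adjoint x, y the norm of x + iy gives |x|^2 <= |x^2 + y^2|, and
   this replaces the functional calculus throughout: it gives
   |t - (1 + G^2)| < t for self-adjoint G and large t, and it deduces
   |t - a| <= t, for some t, from positivity of the spectrum of a.
   Cauchy-Schwarz and uniqueness of positive square roots follow. *)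
Require Import Defs.
From HB Require Import structures.
From mathcomp Require Import all_boot all_order all_algebra.
From mathcomp Require Import complex ring lra.
From mathcomp Require Import all_classical all_reals.
From mathcomp Require Import topology normedtype.

Set Implicit Arguments.
Unset Strict Implicit.
Unset Printing Implicit Defensive.

Import Order.TTheory GRing.Theory Num.Theory.
Import numFieldNormedType.Exports.

Local Open Scope classical_set_scope.
Local Open Scope ring_scope.

(* [abel] decides identities between integral linear combinations in an abelian
   group; [ncring] does so after expanding the products of a noncommutative
   ring. *)
Inductive zexpr := ZVar of nat | ZAdd of zexpr & zexpr | ZOpp of zexpr | ZZero.

Fixpoint zexpr_eval (V : zmodType) (e : seq V) (t : zexpr) : V :=
  match t with
  | ZVar i => e`_i
  | ZAdd t1 t2 => zexpr_eval e t1 + zexpr_eval e t2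
  | ZOpp t1 => - zexpr_eval e t1
  | ZZero => 0
  end.

Fixpoint zexpr_coef (t : zexpr) (i : nat) : int :=
  match t with
  | ZVar j => (i == j)%:Z
  | ZAdd t1 t2 => zexpr_coef t1 i + zexpr_coef t2 i
  | ZOpp t1 => - zexpr_coef t1 i
  | ZZero => 0
  end.

Lemma zexpr_evalE (V : zmodType) (e : seq V) t :
  zexpr_eval e t = \sum_(i < size e) e`_i *~ zexpr_coef t i.
Proof.
elim: t => [j|t1 IH1 t2 IH2|t IH|] /=.
- have [je|je] := ltnP j (size e).
    rewrite (bigD1 (Ordinal je))//= eqxx mulr1z big1 ?addr0// => i.
    by rewrite -val_eqE /= => /negPf ->.
  rewrite nth_default// big1// => i _.
  by rewrite (ltn_eqF (leq_trans (ltn_ord i) je)).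
- by rewrite IH1 IH2 -big_split; apply: eq_bigr => i _; rewrite mulrzDr.
- by rewrite IH -sumrN; apply: eq_bigr => i _; rewrite mulrNz.
- by rewrite big1.
Qed.

(** Soundness of the reflection: the hypothesis is a boolean test on closed integers, so
    [vm_compute] decides it whatever the atoms in [e] are. *)
Lemma zexpr_correct (V : zmodType) (e : seq V) t1 t2 :
  all (fun i => zexpr_coef t1 i == zexpr_coef t2 i) (iota 0 (size e)) ->
  zexpr_eval e t1 = zexpr_eval e t2.
Proof.
move=> /allP H; rewrite !zexpr_evalE; apply: eq_bigr => i _.
by congr (_ *~ _); apply/eqP/H; rewrite mem_iota /=.
Qed.

(** [match goal] makes [unify] run while the index is being built; when it fails, the outer [match]
    moves on to the next atom. Atoms are thus compared by unification. *)
Ltac zindex x e :=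
  match e with
  | ?y :: _ => let _ := match goal with _ => unify x y end in constr:(0%N)
  | _ :: ?e' => let n := zindex x e' in constr:(S n)
  end.

Ltac zatoms t e :=
  lazymatch t with
  | (?a + ?b)%R => let e1 := zatoms a e in zatoms b e1
  | (- ?a)%R => zatoms a e
  | 0%R => e
  | _ =>
    match e with
    | _ => let n := zindex t e in e
    | _ => constr:(t :: e)
    end
  end.

Ltac zquote t e :=
  lazymatch t with
  | (?a + ?b)%R =>
    let x := zquote a e in let y := zquote b e in constr:(ZAdd x y)
  | (- ?a)%R => let x := zquote a e in constr:(ZOpp x)
  | 0%R => constr:(ZZero)
  | _ => let n := zindex t e in constr:(ZVar n)
  end.

Ltac abel :=
  lazymatch goal with
  | |- @eq ?T ?l ?r =>
    let e0 := constr:(@nil T) in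
    let e1 := zatoms l e0 in
    let e := zatoms r e1 in
    let tl := zquote l e in
    let tr := zquote r e in
    refine (@zexpr_correct _ e tl tr _); vm_compute; reflexivity
  end.

Ltac ncring :=
  rewrite ?(mulrDl, mulrDr, mulNr, mulrN, mul1r, mulr1, mulrA, mul0r, mulr0);
  abel.

(** * Norms and bounded operators *)

(** The norm takes values in [R[i]]; its real part loses nothing and lies in an ordered field, where
    [lra] and [nra] apply. *)
Definition nrm (R : realType) (V : normedModType R[i]) (x : V) : R :=
  complex.Re `|x|.

Section RealNorm.
Context {R : realType} {V : normedModType R[i]}.
Implicit Types (x y : V) (a b : R).

Lemma nrmE x : `|x| = (nrm x)%:C%C.
Proof. by rewrite /nrm RRe_real ?normr_real. Qed.

Lemma nrm_le x a : (`|x| <= a%:C%C) = (nrm x <= a).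
Proof. by rewrite nrmE lecR. Qed.

Lemma nrm_ge0 x : 0 <= nrm x.
Proof. by rewrite -lecR -nrmE; exact: normr_ge0. Qed.

Lemma nrm_eq0 x : nrm x = 0 -> x = 0.
Proof. by move=> x0; apply/normr0_eq0; rewrite nrmE x0. Qed.

Lemma nrm0 : nrm (0 : V) = 0.
Proof. by rewrite /nrm normr0. Qed.

Lemma nrmN x : nrm (- x) = nrm x.
Proof. by rewrite /nrm normrN. Qed.

Lemma nrmD x y : nrm (x + y) <= nrm x + nrm y.
Proof. by rewrite -nrm_le rmorphD /= -!nrmE ler_normD. Qed.

Lemma nrmZ (k : R[i]) x : nrm (k *: x) = complex.Re `|k| * nrm x.
Proof.
by apply: complexI; rewrite -nrmE normrZ nrmE rmorphM /= RRe_real ?normr_real.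
Qed.

Lemma nrmZr a x : nrm (a%:C%C *: x) = `|a| * nrm x.
Proof. by rewrite nrmZ normc_def /= expr0n addr0 sqrtr_sqr. Qed.

End RealNorm.

Lemma le0_small (R : realFieldType) (a : R) :
  (forall e, 0 < e -> a <= e) -> a <= 0.
Proof. by move=> h; apply/ler_addgt0Pl => e e0; rewrite addr0 h. Qed.

(** By Bernoulli's inequality for [r^-1 = 1 + h], the powers of [r^-1] outgrow [C / e]. *)
Lemma geometric_small (R : realType) (C r e : R) : 0 <= r < 1 -> 0 < e ->
  exists n, C * r ^+ n <= e.
Proof.
move=> /andP[r0 r1] e0.
have [C0|C0] := leP C 0.
  by exists 0%N; rewrite expr0 mulr1 (le_trans C0)// ltW.
have [->|rn0] := eqVneq r 0; first by exists 1%N; rewrite expr1 mulr0 ltW.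
have rp : 0 < r by rewrite lt_neqAle eq_sym rn0.
pose h := r^-1 - 1.
have h0 : 0 < h by rewrite subr_gt0 invf_gt1.
have bern n : 1 + n%:R * h <= (r^-1) ^+ n.
  elim: n => [|n IH]; first by rewrite mul0r addr0 expr0.
  rewrite exprS; apply: le_trans (_ : (1 + h) * (1 + n%:R * h) <= _).
    have := mulr_ge0 (ler0n R n) (sqr_ge0 h); rewrite -natr1; nra.
  by rewrite /h [1 + _]addrC subrK ler_pM2l ?invr_gt0.
have [n Hn] : exists n : nat, C / e / h <= n%:R.
  exists (Num.bound (C / e / h)).
  by apply/ltW/archi_boundP; rewrite !divr_ge0// ltW.
exists n; rewrite -[r]invrK exprVn ler_pdivrMr ?exprn_gt0 ?invr_gt0//.
rewrite mulrC -ler_pdivrMr// (le_trans _ (bern n))//.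
by move: Hn; rewrite ler_pdivrMr// => /le_trans ->//; rewrite lerDr.
Qed.

Section Complete.
Context {R : realType} {V : completeNormedModType R[i]}.

(** Summing the geometric tail gives the Cauchy property. The error bound at every index is kept,
    since later identities for limits are read off from it. *)
Lemma complete_geometric (u : nat -> V) (d : nat -> R) (r : R) :
  0 <= r < 1 -> (forall n, d n.+1 <= r * d n) ->
  (forall n, nrm (u n.+1 - u n) <= d n) ->
  exists l, forall n, nrm (l - u n) <= d n / (1 - r).
Proof.
move=> /andP[r0 r1] dr ud.
have r1' : 0 < 1 - r by rewrite subr_gt0.
have d0 n : 0 <= d n by rewrite (le_trans (nrm_ge0 _) (ud n)).
have dn n : d n <= d 0%N * r ^+ n.
  elim: n => [|n IH]; first by rewrite expr0 mulr1.
  by rewrite (le_trans (dr n))// exprS mulrCA ler_wpM2l.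
have tail n k : nrm (u (n + k)%N - u n) <= d n / (1 - r).
  elim: k n => [|k IH] n.
    by rewrite addn0 subrr nrm0 divr_ge0// ltW.
  rewrite -addSnnS -(subrK (u n.+1) (u (n.+1 + k)%N)) -addrA.
  rewrite (le_trans (nrmD _ _))// (le_trans (lerD (IH _) (ud n)))//.
  rewrite ler_pdivlMr// mulrDl divfK ?gt_eqF//.
  by have := dr n; lra.
have uc : cvg (u @ \oo).
  apply/cauchy_cvgP/cauchy_exP => e e0.
  have eE : e = (complex.Re e)%:C%C.
    by rewrite RRe_real ?gtr0_real.
  have e'0 : 0 < complex.Re e by rewrite -ltcR -eE.
  have [N HN] := geometric_small (d 0%N / (1 - r))
    (introT andP (conj r0 r1)) (divr_gt0 e'0 (ltr0n R 2)).
  exists (u N), N => // n /= Nn.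
  rewrite -ball_normE /= distrC nrmE eE ltcR -(subnKC Nn).
  rewrite (le_lt_trans (tail N _))//.
  have := ler_wpM2r (ltW (etrans (invr_gt0 _) r1')) (dn N).
  by move: HN; rewrite mulrAC; lra.
exists (lim (u @ \oo)) => n; apply/ler_addgt0Pr => e e0.
have /cvgrPdist_lt /(_ e%:C%C) := uc.
rewrite ltcR => /(_ e0) [N _ HN].
have := HN (n + N)%N (leq_addl _ _); rewrite nrmE ltcR => H1.
rewrite -(subrK (u (n + N)%N) (lim _)) -addrA (le_trans (nrmD _ _))//.
by have := tail n N; lra.
Qed.

End Complete.

Definition inrm (R : realType) (A : cstarAlgType R) (E : innerModType A)
  (x : E) : R := Num.sqrt (nrm (inner x x : A)).

(* Completeness is stated for the sequences whose steps are dominated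
   geometrically, the only ones that occur below. *)
HB.mixin Record InnerModule_isBanach (R : realType) (A : cstarAlgType R) V
    of InnerModule R A V := {
  nrm_inner : forall x y : V, nrm (inner x y : A) <= inrm x * inrm y;
  inner_xx_eq0 : forall x : V, (inner x x : A) = 0 -> x = 0;
  inrm_complete : forall (u : nat -> V) (d : nat -> R) (r : R),
    0 <= r < 1 -> (forall n, d n.+1 <= r * d n) ->
    (forall n, inrm (u n.+1 - u n) <= d n) ->
    exists l, forall n, inrm (l - u n) <= d n / (1 - r) }.

#[short(type="banachInnerModType")]
HB.structure Definition BanachInnerModule (R : realType) (A : cstarAlgType R) :=
  { V of InnerModule R A V & InnerModule_isBanach R A V }.

Section Bounded.
Context {R : realType} {A : cstarAlgType R} {V : banachInnerModType A}.
Implicit Types (T : 'L(V)) (x y z : V).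

Lemma nrm_inner_xx x : nrm (inner x x : A) = inrm x ^+ 2.
Proof. by rewrite sqr_sqrtr// nrm_ge0. Qed.

Lemma inrm_ge0 x : 0 <= inrm x.
Proof. exact: sqrtr_ge0. Qed.

Lemma inrm_eq0 x : inrm x = 0 -> x = 0.
Proof. by move=> x0; apply/inner_xx_eq0/nrm_eq0; rewrite nrm_inner_xx x0 expr0n. Qed.

Lemma inrm0 : inrm (0 : V) = 0.
Proof. by rewrite /inrm inner0r nrm0 sqrtr0. Qed.

Lemma inrmN x : inrm (- x) = inrm x.
Proof. by rewrite /inrm innerNl innerNr opprK. Qed.

Lemma inrmB x y : inrm (x - y) = inrm (y - x).
Proof. by rewrite -inrmN opprB. Qed.

Lemma inrmD x y : inrm (x + y) <= inrm x + inrm y.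
Proof.
rewrite -(@ler_pXn2r _ 2) ?nnegrE ?addr_ge0 ?inrm_ge0//.
rewrite -nrm_inner_xx innerDl !innerDr (le_trans (nrmD _ _))//.
rewrite (le_trans (lerD (nrmD _ _) (nrmD _ _)))// !nrm_inner_xx.
have := nrm_inner x y; have := nrm_inner y x; nra.
Qed.

Lemma inrmZ (k : R[i]) x : inrm (k *: x) = complex.Re `|k| * inrm x.
Proof.
have k0 : 0 <= complex.Re `|k|.
  by rewrite -lecR RRe_real ?normr_real//; exact: normr_ge0.
rewrite /inrm innerZl innerZr scalerA nrmZ sqrtrM; last first.
  by rewrite -lecR RRe_real ?normr_real//; exact: normr_ge0.
congr (_ * _); rewrite mulrC -normCK.
rewrite normrX normr_id -[`|k|]RRe_real ?normr_real// -rmorphXn /=.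
by rewrite sqrtr_sqr ger0_norm.
Qed.

Lemma inrmZr (a : R) x : inrm (a%:C%C *: x) = `|a| * inrm x.
Proof. by rewrite inrmZ normc_def /= expr0n addr0 sqrtr_sqr. Qed.

Lemma binner_inj x y : (forall z, inner x z = inner y z) -> x = y.
Proof.
move=> xy; apply/eqP; rewrite -subr_eq0; apply/eqP/inner_xx_eq0.
by rewrite innerDl innerNl xy subrr.
Qed.

Lemma inner_adj T x y : inner (T x) y = inner x (adj T y).
Proof. exact: adjP. Qed.

Lemma inner_adjl T x y : inner x (T y) = inner (adj T x) y.
Proof. by rewrite -inner_star inner_adj inner_star. Qed.

Lemma adj_eq (T S : 'L(V)) : adjoint_of T S -> adj T = S.
Proof.
move=> TS; apply: adjop_ext => y; apply: binner_inj => x.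
by rewrite -inner_star -[RHS]inner_star -TS -inner_adj.
Qed.

Lemma opD T x y : T (x + y) = T x + T y.
Proof.
by apply: binner_inj => z; rewrite innerDl !inner_adj innerDl.
Qed.

Lemma opZ T (k : R[i]) x : T (k *: x) = k *: T x.
Proof. by apply: binner_inj => z; rewrite innerZl !inner_adj innerZl. Qed.

Lemma opN T x : T (- x) = - T x.
Proof. by rewrite -scaleN1r opZ scaleN1r. Qed.

(* The gliding hump: [z n] moves by small steps along which [inrm (T z)] exceeds
   [n]; since [{z | inrm (T z) > n}] is open by weak continuity of T, these
   inequalities survive in the limit. *)
Lemma op_bounded T : exists2 M, 0 <= M & forall x, inrm (T x) <= M * inrm x.
Proof.
apply: contrapT => unb.
have big (c e : R) : 0 < e -> exists x, inrm x <= e /\ c < inrm (T x).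
  move=> e0; apply: contrapT => H; apply: unb.
  exists (`|c| / e); first by rewrite divr_ge0// ltW.
  move=> x; have [->|x0] := eqVneq x 0.
    by rewrite inrm0 mulr0 -(scale0r 0) opZ scale0r inrm0.
  have nx : 0 < inrm x.
    by rewrite lt_neqAle inrm_ge0 andbT eq_sym; apply: contra_neq x0 => /inrm_eq0.
  case: leP => // Tx.
  case: H; exists ((e / inrm x)%:C%C *: x); rewrite opZ !inrmZr.
  rewrite ger0_norm; last exact: divr_ge0 (ltW e0) (inrm_ge0 x).
  split.
    by rewrite divfK// gt_eqF.
  apply: le_lt_trans (ler_norm c) _.
  have -> : `|c| = e / inrm x * (`|c| / e * inrm x) by field; rewrite !gt_eqF.
  by rewrite ltr_pM2l// divr_gt0.
have opn (c : R) (z : V) : c < inrm (T z) ->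
    exists2 d, 0 < d & forall w, inrm (z - w) < d -> c < inrm (T w).
  move=> cz; have Tz0 : inrm (T z) != 0 \/ c < 0.
    by have [Tz|] := eqVneq (inrm (T z)) 0; [right; rewrite -Tz | left].
  case: Tz0 => [Tz0|c0]; last first.
    by exists 1 => // w _; rewrite (lt_le_trans c0)// inrm_ge0.
  have Tzp : 0 < inrm (T z) by rewrite lt_neqAle eq_sym Tz0 inrm_ge0.
  pose K := inrm (adj T (T z)).
  have K0 : 0 <= K := inrm_ge0 _.
  have K1 : 0 < K + 1 by lra.
  (* Splitting [z] as [(z - w) + w] gives [|Tz|^2 <= |Tz| |Tw| + K |z - w|]; this radius keeps the
     last term below [(|Tz| - c) |Tz|]. The [+ 1] covers [K = 0]. *)
  exists ((inrm (T z) - c) * inrm (T z) / (K + 1)).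
    by rewrite divr_gt0// mulr_gt0// subr_gt0.
  move=> w; rewrite ltr_pdivlMr// => dw.
  have H1 : inrm (T z) ^+ 2 <= inrm (T z) * inrm (T w) + K * inrm (z - w).
    rewrite -nrm_inner_xx -[X in inner _ (T X)](subrK w z) opD innerDr addrC.
    rewrite (le_trans (nrmD _ _))// lerD ?nrm_inner//.
    by rewrite inner_adjl nrm_inner.
  have := inrm_ge0 (z - w) => d0.
  rewrite -(ltr_pM2l Tzp); nra.
pose good (n : nat) (p : V * R) := 0 < p.2 /\
  (forall w, inrm (p.1 - w) < p.2 -> n%:R < inrm (T w)).
have step n (p : V * R) : exists q, 0 < p.2 ->
    [/\ good n q, inrm (q.1 - p.1) <= p.2 / 4 & q.2 <= 4^-1 * p.2].
  case: p => z d /=; have [d0|_] := ltP 0 d; last by exists (z, d).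
  have [x [xd xT]] := big n%:R (d / 4) (divr_gt0 d0 (ltr0n R 4)).
  (* [2 T x = T (z + x) - T (z - x)], so a large [T x] forces one of the two images to be large. *)
  have [w [wd wT]] : exists w, inrm (w - z) <= d / 4 /\ n%:R < inrm (T w).
    have [H|H] := ltP n%:R (inrm (T (z + x))).
      by exists (z + x); rewrite addrC addKr.
    exists (z - x); rewrite addrC addKr inrmN; split=> //.
    apply: contraTT xT; rewrite -!leNgt => H'.
    have : inrm (T x) * 2 <= inrm (T (z + x)) + inrm (T (z - x)).
      rewrite -[inrm (T (z - x))]inrmN (le_trans _ (inrmD _ _))//.
      rewrite !opD opN opprD opprK addrACA subrr add0r.
      have -> : T x + T x = (2 : R)%:C%C *: T x.
        by rewrite rmorph_nat scaler_nat mulr2n.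
      by rewrite inrmZr normr_nat mulrC.
    lra.
  have [e e0 He] := opn _ _ wT.
  exists (w, Num.min e (4^-1 * d)) => _; split=> //=; last by rewrite ge_min lexx orbT.
  split=> /= [|w']; first by rewrite lt_min e0 mulr_gt0 ?invr_gt0.
  by rewrite lt_min => /andP[/He].
have [f Hf] : {f : nat -> V * R -> V * R | forall n p, 0 < p.2 ->
    [/\ good n (f n p), inrm ((f n p).1 - p.1) <= p.2 / 4 & (f n p).2 <= 4^-1 * p.2]}.
  exists (fun n p => projT1 (cid (step n p))) => n p.
  by case: (cid _).
pose s := fix s n := if n is m.+1 then f m (s m) else (0 : V, 1 : R).
have s0 n : 0 < (s n).2 by elim: n => //= n /(Hf n)[[]].
have r41 : 0 <= (4^-1 : R) < 1 by lra.
have sd n : (s n.+1).2 / 4 <= 4^-1 * ((s n).2 / 4).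
  by have [_ _] := Hf n _ (s0 n); rewrite /=; lra.
have su n : inrm ((s n.+1).1 - (s n).1) <= (s n).2 / 4.
  by have [_] := Hf n _ (s0 n).
have [l Hl] := inrm_complete _ _ _ r41 sd su.
have lT n : n%:R < inrm (T l).
  (* The limit is within [r / 3] of [(s n.+1).1], where [r = (s n.+1).2], hence in the ball to which
     [good n] refers. *)
  have [[_ H] _ _] := Hf n _ (s0 n); apply: H.
  rewrite inrmB (le_lt_trans (Hl n.+1))//=.
  by have := s0 n.+1; rewrite /= ltr_pdivrMr; lra.
have := lT (Num.bound (inrm (T l))).
by rewrite ltNge ltW// archi_boundP// inrm_ge0.
Qed.

End Bounded.

(** * The ring of adjointable operators and its norm *)

Section OperatorRing.
Context {R : realType} {A : cstarAlgType R} {V : banachInnerModType A}.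

Fact compL_mulA : associative (fun S T : 'L(V) => S \oL T).
Proof. by move=> S T U; apply: adjop_ext. Qed.
Fact compL_mul1 : left_id idL (fun S T : 'L(V) => S \oL T).
Proof. by move=> S; apply: adjop_ext. Qed.
Fact compL_1mul : right_id idL (fun S T : 'L(V) => S \oL T).
Proof. by move=> S; apply: adjop_ext. Qed.
Fact compL_mulDl : left_distributive (fun S T : 'L(V) => S \oL T) +%R.
Proof. by move=> S T U; apply: adjop_ext. Qed.
Fact compL_mulDr : right_distributive (fun S T : 'L(V) => S \oL T) +%R.
Proof. by move=> S T U; apply: adjop_ext => x /=; rewrite opD. Qed.

HB.instance Definition _ := GRing.Zmodule_isPzRing.Build 'L(V)
  compL_mulA compL_mul1 compL_1mul compL_mulDl compL_mulDr.

Implicit Types (S T U X Y : 'L(V)).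

Lemma mulLE S T : S * T = S \oL T. Proof. by []. Qed.

Lemma scaleLAl (k : R[i]) S T : k *: (S * T) = (k *: S) * T.
Proof. by apply: adjop_ext. Qed.

Lemma scaleLAr (k : R[i]) S T : k *: (S * T) = S * (k *: T).
Proof. by apply: adjop_ext => x; rewrite /= opZ. Qed.

Lemma adjK T : adj (adj T) = T.
Proof. by apply: adj_eq => x y; rewrite inner_adjl. Qed.

Lemma adj1 : adj (1 : 'L(V)) = 1.
Proof. exact: adj_eq. Qed.

Lemma adj0 : adj (0 : 'L(V)) = 0.
Proof. by apply: adj_eq => x y; rewrite /= inner0l inner0r. Qed.

Lemma adjD S T : adj (S + T) = adj S + adj T.
Proof.
by apply: adj_eq => x y; rewrite /= innerDl innerDr !inner_adj.
Qed.

Lemma adjN T : adj (- T) = - adj T.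
Proof. by apply: adj_eq => x y; rewrite /= innerNl innerNr inner_adj. Qed.

Lemma adjB S T : adj (S - T) = adj S - adj T.
Proof. by rewrite adjD adjN. Qed.

Lemma adjM S T : adj (S * T) = adj T * adj S.
Proof. by apply: adj_eq => x y; rewrite /= !inner_adj. Qed.

Lemma adjZ (k : R[i]) T : adj (k *: T) = Num.conj k *: adj T.
Proof. by apply: adj_eq => x y; rewrite /= innerZl innerZr inner_adj. Qed.

Definition constL (a : R) : 'L(V) := a%:C%C *: idL.

Lemma constL0 : constL 0 = 0. Proof. by rewrite /constL rmorph0 scale0r. Qed.
Lemma constL1 : constL 1 = 1. Proof. by rewrite /constL rmorph1 scale1r. Qed.
Lemma constLN a : constL (- a) = - constL a.
Proof. by rewrite /constL rmorphN scaleNr. Qed.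
Lemma constLD a b : constL (a + b) = constL a + constL b.
Proof. by rewrite /constL rmorphD scalerDl. Qed.
Lemma constLB a b : constL (a - b) = constL a - constL b.
Proof. by rewrite constLD constLN. Qed.
Lemma constLM a b : constL (a * b) = constL a * constL b.
Proof. by rewrite /constL rmorphM /= -scaleLAl mul1r scalerA. Qed.
Lemma constLX a n : constL (a ^+ n) = constL a ^+ n.
Proof. by elim: n => [|n IH]; rewrite ?constL1 // !exprS constLM IH. Qed.
Lemma constLC a T : GRing.comm (constL a) T.
Proof. by rewrite /GRing.comm -scaleLAl -scaleLAr mul1r mulr1. Qed.
Lemma constLE a (x : V) : constL a x = a%:C%C *: x. Proof. by []. Qed.
Lemma adj_constL a : adj (constL a) = constL a.
Proof.
by rewrite /constL adjZ adj1 conj_Creal// complex_real.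
Qed.
Lemma constLV a : a != 0 -> constL a * constL a^-1 = 1.
Proof. by move=> a0; rewrite -constLM divff// constL1. Qed.

(** The operator norm as an infimum of bounds: [op_bounded] makes the set nonempty, and [opnP] shows
    that the infimum is attained. *)
Definition opn T : R :=
  inf [set M : R | 0 <= M /\ forall x : V, inrm (T x) <= M * inrm x].

Lemma opn_has_inf T :
  has_inf [set M : R | 0 <= M /\ forall x : V, inrm (T x) <= M * inrm x].
Proof.
split; first by have [M M0 HM] := op_bounded T; exists M.
by exists 0 => M [].
Qed.

Lemma opn_ge0 T : 0 <= opn T.
Proof. by apply: lb_le_inf; [have [] := opn_has_inf T | move=> M []]. Qed.

Lemma opnP T (x : V) : inrm (T x) <= opn T * inrm x.
Proof.
have := inrm_ge0 x; rewrite le_eqVlt => /predU1P[/esym x0|x0].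
  have [M _ /(_ x)] := op_bounded T.
  by rewrite x0 !mulr0.
rewrite -ler_pdivrMr//; apply: lb_le_inf; first by have [] := opn_has_inf T.
by move=> M [_ /(_ x)]; rewrite ler_pdivrMr.
Qed.

Lemma opn_le T M : 0 <= M -> (forall x : V, inrm (T x) <= M * inrm x) ->
  opn T <= M.
Proof. by move=> M0 HM; apply: ge_inf; [exists 0 => N [] | split]. Qed.

Lemma opn_trans T a (x : V) : opn T <= a -> inrm (T x) <= a * inrm x.
Proof. by move=> Ta; rewrite (le_trans (opnP T x))// ler_wpM2r// inrm_ge0. Qed.

Lemma opn_eq0 T : opn T <= 0 -> T = 0.
Proof.
move=> T0; apply: adjop_ext => x /=; apply: inrm_eq0; apply/eqP.
by rewrite eq_le inrm_ge0 andbT (le_trans (opn_trans x T0))// mul0r.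
Qed.

Lemma opn_small T : (forall e, 0 < e -> opn T <= e) -> T = 0.
Proof. by move=> /le0_small/opn_eq0. Qed.

Lemma opnN T : opn (- T) = opn T.
Proof. by rewrite /opn; congr inf; apply/seteqP; split => M [M0 H];
  split=> // x; have := H x; rewrite /= inrmN. Qed.

Lemma opnD S T : opn (S + T) <= opn S + opn T.
Proof.
apply: opn_le => [|x]; first by rewrite addr_ge0 ?opn_ge0.
by rewrite mulrDl (le_trans (inrmD _ _))// lerD ?opnP.
Qed.

Lemma opnB S T : opn (S - T) <= opn S + opn T.
Proof. by rewrite -[opn T]opnN opnD. Qed.

Lemma opnM S T : opn (S * T) <= opn S * opn T.
Proof.
apply: opn_le => [|x]; first by rewrite mulr_ge0 ?opn_ge0.
rewrite (le_trans (opnP S _))// -mulrA ler_wpM2l ?opn_ge0//; exact: opnP.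
Qed.

Lemma opn_constM a T : opn (constL a * T) <= `|a| * opn T.
Proof.
apply: opn_le => [|x]; first by rewrite mulr_ge0 ?opn_ge0.
by rewrite mulLE /= inrmZr -mulrA ler_wpM2l// opnP.
Qed.

Lemma opn_const a : opn (constL a) <= `|a|.
Proof. by apply: opn_le => // x; rewrite constLE inrmZr. Qed.

Lemma opn1 : opn 1 <= 1.
Proof. by rewrite -constL1 (le_trans (opn_const _))// normr1. Qed.

Lemma opnX T n : opn (T ^+ n) <= opn T ^+ n.
Proof.
elim: n => [|n IH]; first exact: opn1.
by rewrite !exprS (le_trans (opnM _ _))// ler_wpM2l ?opn_ge0.
Qed.

(** Cauchy-Schwarz applied to [<Tx, Tx> = <x, adj T (T x)>]: the nontrivial half of the
    C*-identity. *)
Lemma opn_sqr T : opn T ^+ 2 <= opn (adj T * T).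
Proof.
have s0 : 0 <= opn (adj T * T) := opn_ge0 _.
suff : opn T <= Num.sqrt (opn (adj T * T)).
  by move=> H; rewrite -[leRHS]sqr_sqrtr// ler_pXn2r// nnegrE ?opn_ge0 ?sqrtr_ge0.
apply: opn_le => [|x]; first exact: sqrtr_ge0.
rewrite -(@ler_pXn2r _ 2) ?nnegrE ?mulr_ge0 ?sqrtr_ge0 ?inrm_ge0//.
rewrite -nrm_inner_xx exprMn [X in X * _]sqr_sqrtr// inner_adj.
rewrite (le_trans (nrm_inner _ _))//.
by rewrite mulrC expr2 mulrA ler_wpM2r ?inrm_ge0//; exact: (opnP (adj T * T)).
Qed.

Lemma opn_adj T : opn (adj T) = opn T.
Proof.
suff le S : opn S <= opn (adj S).
  by apply/eqP; rewrite eq_le le andbT -[leRHS](congr1 opn (adjK T)) le.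
have := opn_ge0 S; rewrite le_eqVlt => /predU1P[<-|S0]; first exact: opn_ge0.
by rewrite -(ler_pM2r S0) -expr2 (le_trans (opn_sqr S))// opnM.
Qed.

Definition sa T := adj T = T.

Lemma saD S T : sa S -> sa T -> sa (S + T).
Proof. by rewrite /sa adjD => -> ->. Qed.
Lemma saN T : sa T -> sa (- T).
Proof. by rewrite /sa adjN => ->. Qed.
Lemma saB S T : sa S -> sa T -> sa (S - T).
Proof. by move=> sS sT; apply/saD/saN. Qed.
Lemma saM S T : sa S -> sa T -> GRing.comm S T -> sa (S * T).
Proof. by rewrite /sa adjM => -> ->. Qed.
Lemma sa1 : sa 1. Proof. exact: adj1. Qed.
Lemma sa_constL a : sa (constL a). Proof. exact: adj_constL. Qed.

Lemma sa_opn_sqr T : sa T -> opn (T * T) = opn T ^+ 2.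
Proof.
by move=> sT; apply/eqP; rewrite eq_le expr2 opnM -expr2 -{2}sT opn_sqr.
Qed.

(** The limit must again have an adjoint, so [T n] and [adj (T n)] are followed to pointwise limits
    at the same rate, and the adjoint relation passes to these limits. *)
Lemma opL_complete (T : nat -> 'L(V)) (d : nat -> R) (r : R) :
  0 <= r < 1 -> (forall n, d n.+1 <= r * d n) ->
  (forall n, opn (T n.+1 - T n) <= d n) ->
  exists L, forall n, opn (L - T n) <= d n / (1 - r).
Proof.
move=> r01 dr Td; have /andP[r0 r1] := r01.
have ptw (S : nat -> 'L(V)) : (forall n, opn (S n.+1 - S n) <= d n) ->
    {f : V -> V | forall x n, inrm (f x - S n x) <= d n / (1 - r) * inrm x}.
  move=> Sd; have /choice[f Hf] : forall x : V, exists y, forall n,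
      inrm (y - S n x) <= d n / (1 - r) * inrm x.
    move=> x; have [] := inrm_complete (fun n => S n x)
        (fun n => d n * inrm x) _ r01.
    - by move=> n; rewrite mulrA ler_wpM2r ?inrm_ge0.
    - by move=> n; have := opn_trans x (Sd n).
    - by move=> l Hl; exists l => n; rewrite mulrAC.
  by exists f.
have [f Hf] := ptw T Td.
have [g Hg] : {g : V -> V |
    forall x n, inrm (g x - adj (T n) x) <= d n / (1 - r) * inrm x}.
  by apply: ptw => n; rewrite -adjB opn_adj.
have d0 n : 0 <= d n by rewrite (le_trans (opn_ge0 _) (Td n)).
have dn n : d n <= d 0%N * r ^+ n.
  elim: n => [|n IH]; first by rewrite expr0 mulr1.
  by rewrite (le_trans (dr n))// exprS mulrCA ler_wpM2l.
have fg : adjoint_of f g.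
  move=> x y; apply/eqP; rewrite -subr_eq0; apply/eqP/nrm_eq0/eqP.
  rewrite eq_le nrm_ge0 andbT; apply: le0_small => e e0.
  have [n Hn] := geometric_small (2 * d 0%N / (1 - r) * (inrm x * inrm y)) r01 e0.
  have -> : inner (f x) y - inner x (g y) =
      inner (f x - T n x) y - inner x (g y - adj (T n) y).
    by rewrite innerDl innerNl innerDr innerNr inner_adj opprB addrA subrK.
  apply: le_trans Hn; rewrite (le_trans (nrmD _ _))// nrmN.
  have xy0 : 0 <= inrm x * inrm y by rewrite mulr_ge0 ?inrm_ge0.
  have H1 : nrm (inner (f x - T n x) y) <= d n / (1 - r) * (inrm x * inrm y).
    by rewrite (le_trans (nrm_inner _ _))// mulrA ler_wpM2r ?inrm_ge0.
  have H2 : nrm (inner x (g y - adj (T n) y)) <=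
      d n / (1 - r) * (inrm x * inrm y).
    by rewrite (le_trans (nrm_inner _ _))// mulrCA ler_wpM2l ?inrm_ge0.
  have H3 : d n / (1 - r) * (inrm x * inrm y) <=
      d 0%N * r ^+ n / (1 - r) * (inrm x * inrm y).
    by rewrite !ler_wpM2r// invr_ge0 subr_ge0 ltW.
  rewrite (le_trans (lerD (le_trans H1 H3) (le_trans H2 H3)))//.
  by rewrite le_eqVlt; apply/orP; left; apply/eqP; ring.
have fP : exists S : V -> V, adjoint_of f S by exists g.
exists (AdjOp fP) => n; apply: opn_le => [|x]; last exact: Hf.
by rewrite divr_ge0// subr_ge0 ltW.
Qed.

End OperatorRing.
(** * Square roots and positivity *)

Section OperatorAlgebra.
Context {R : realType} {A : cstarAlgType R} {V : banachInnerModType A}.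
Implicit Types (S T U X Y Z P G : 'L(V)) (a b c r t e m : R).
Local Notation "a %:L" := (constL (V := V) a)
  (at level 1, left associativity, format "a %:L").

Definition invertibleL T := exists S, S * T = 1 /\ T * S = 1.

Lemma opn_geometric T C r : 0 <= r < 1 -> (forall n, opn T <= C * r ^+ n) ->
  T = 0.
Proof.
move=> r01 H; apply: opn_small => e e0.
by have [n] := geometric_small C r01 e0; apply: le_trans.
Qed.

Lemma commr_constL a T : GRing.comm T a%:L.
Proof. exact/commr_sym/constLC. Qed.

(** The Neumann series: the product of [1 - X] with a partial sum telescopes to [1 - X ^+ n], on
    either side. *)
Lemma neumann X : opn X < 1 -> invertibleL (1 - X).
Proof.
move=> X1; have r01 : 0 <= opn X < 1 by rewrite opn_ge0.
pose y n := \sum_(i < n) X ^+ i.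
have [L HL] : exists L, forall n, opn (L - y n) <= opn X ^+ n / (1 - opn X).
  apply: opL_complete r01 _ _ => n; first by rewrite exprS.
  rewrite /y big_ord_recr/= [X in opn (X - _)]addrC addrK; exact: opnX.
have yE n : (1 - X) * y n = 1 - X ^+ n.
  by rewrite -opprB mulNr /y -subrX1 opprB.
have yC n : y n * (1 - X) = (1 - X) * y n.
  apply: commr_sym; apply: commr_sum => i _; apply: commr_sym.
  by apply: commrB; [exact: commr1|apply: commr_sym; exact: commrX].
have bound T n : opn T <= opn (1 - X) * (opn X ^+ n / (1 - opn X)) ->
    opn (T - X ^+ n) <= (opn (1 - X) / (1 - opn X) + 1) * opn X ^+ n.
  move=> H; rewrite (le_trans (opnB _ _))// (le_trans (lerD H (opnX _ _)))//.
  by rewrite mulrDl mul1r mulrA mulrAC.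
exists L; split; apply/eqP; rewrite -subr_eq0; apply/eqP;
  apply: (opn_geometric r01) => n.
- have -> : L * (1 - X) - 1 = (L - y n) * (1 - X) - X ^+ n.
    by rewrite mulrBl yC yE opprB addrA [RHS]addrAC addrK.
  by apply: bound; rewrite (le_trans (opnM _ _))// mulrC ler_wpM2l ?opn_ge0.
- have -> : (1 - X) * L - 1 = (1 - X) * (L - y n) - X ^+ n.
    by rewrite mulrBr yE opprB addrA [RHS]addrAC addrK.
  by apply: bound; rewrite (le_trans (opnM _ _))// ler_wpM2l ?opn_ge0.
Qed.

(** The iterates stay in the ball of radius [q = opn X], where [Y |-> (X + Y^2) / 2] contracts by
    [q]. They lie in the algebra generated by [X], whence the commutation clause. *)
Lemma sqrt1B X : sa X -> opn X < 1 ->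
  exists Y, [/\ sa Y, opn Y <= opn X, (1 - Y) * (1 - Y) = 1 - X
    & forall Z, GRing.comm Z X -> GRing.comm Z Y].
Proof.
move=> sX X1; have r0 := opn_ge0 X.
have r01 : 0 <= opn X < 1 by rewrite r0.
pose y := fix y n := if n is m.+1 then 2^-1%:L * (X + y m * y m) else 0 : 'L(V).
have yS n : y n.+1 = 2^-1%:L * (X + y n * y n) by [].
have half T : opn (2^-1%:L * T) <= 2^-1 * opn T.
  by rewrite (le_trans (opn_constM _ _))// ger0_norm ?invr_ge0.
have double T : 2%:L * (2^-1%:L * T) = T by rewrite mulrA constLV ?mul1r ?pnatr_eq0.
have ysa n : sa (y n).
  elim: n => [|n IH]; first exact: adj0.
  apply: saM (sa_constL _) _ _; last exact: constLC.
  by apply: saD => //; exact: saM.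
have yb n : opn (y n) <= opn X.
  elim: n => [|n IH]; first by
    rewrite (le_trans (opn_le (lexx 0) _))// => x; rewrite inrm0 mul0r.
  rewrite yS (le_trans (half _))//.
  have := le_trans (opnD _ _) (lerD (lexx (opn X)) (opnM (y n) (y n))).
  have := opn_ge0 (y n); nra.
have yC Z n : GRing.comm Z X -> GRing.comm Z (y n).
  move=> ZX; elim: n => [|n IH]; first exact: commr0.
  by apply: commrM; [exact: commr_constL|apply: commrD => //; exact: commrM].
have sqB S T : S * S - T * T = S * (S - T) + (S - T) * T.
  by rewrite mulrBr mulrBl addrA subrK.
have yd n : opn (y n.+1 - y n) <= opn X ^+ n.
  elim: n => [|n IH].
    rewrite subr0 expr0 (le_trans (yb 1%N))//; exact: ltW.
  rewrite [y n.+2]yS {2}yS -mulrBr (le_trans (half _))// opprD addrACA subrr.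
  rewrite add0r sqB exprS.
  have := le_trans (opnD _ _) (lerD (opnM (y n.+1) (y n.+1 - y n))
     (opnM (y n.+1 - y n) (y n))).
  have := yb n; have := yb n.+1; have := opn_ge0 (y n.+1 - y n).
  move: (opn _) (opn _) (opn _) (opn _) IH r0 => a b c d; nra.
have [L HL] : exists L, forall n, opn (L - y n) <= opn X ^+ n / (1 - opn X).
  by apply: opL_complete r01 _ yd => n; rewrite exprS.
pose K := (1 - opn X)^-1.
have K0 : 0 <= K by rewrite invr_ge0 subr_ge0 ltW.
have Ln n : opn L <= opn X + K * opn X ^+ n.
  rewrite -(subrK (y n) L) (le_trans (opnD _ _))// addrC lerD//.
  by rewrite mulrC.
have LX : opn L <= opn X.
  apply/ler_addgt0Pr => e e0; have [n Hn] := geometric_small K r01 e0.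
  by rewrite (le_trans (Ln n))// lerD2l.
have HL' n : opn (L - y n) <= K * opn X ^+ n by rewrite mulrC.
exists L; split=> //.
- apply/eqP; rewrite -subr_eq0; apply/eqP; apply: (@opn_geometric _ (2 * K) _ r01) => n.
  have -> : adj L - L = adj (L - y n) - (L - y n).
    by rewrite adjB ysa opprB addrA subrK.
  rewrite (le_trans (opnB _ _))// opn_adj -mulrA.
  by have := HL' n; lra.
- apply/eqP; rewrite -subr_eq0; apply/eqP; apply: (@opn_geometric _ (4 * K) _ r01) => n.
  (* Since twice [y n.+1] is [X + y n * y n], the defect is a combination of the errors at steps [n]
     and [n.+1]. *)
  have -> : (1 - L) * (1 - L) - (1 - X) =
      L * (L - y n) + (L - y n) * y n - 2%:L * (L - y n.+1).
    have -> : 2%:L * (L - y n.+1) = L + L - (X + y n * y n).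
      by rewrite mulrBr yS double (_ : 2 = 1 + 1)// constLD constL1 mulrDl mul1r.
    by ncring.
  have H2 : opn (2%:L * (L - y n.+1)) <= 2 * (K * opn X ^+ n.+1).
    by rewrite (le_trans (opn_constM _ _))// ger0_norm// ler_wpM2l.
  have H3 : opn (L * (L - y n)) <= K * opn X ^+ n.
    rewrite (le_trans (opnM _ _))// (le_trans _ (HL' n))// ler_piMl ?opn_ge0//.
    by rewrite (le_trans LX)// ltW.
  have H4 : opn ((L - y n) * y n) <= K * opn X ^+ n.
    rewrite (le_trans (opnM _ _))// (le_trans _ (HL' n))// ler_piMr ?opn_ge0//.
    by rewrite (le_trans (yb n))// ltW.
  have H5 : K * opn X ^+ n.+1 <= K * opn X ^+ n.
    by rewrite ler_wpM2l// exprS ler_piMl ?exprn_ge0// ltW.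
  rewrite (le_trans (opnB _ _))//.
  by have := opnD (L * (L - y n)) ((L - y n) * y n); lra.
- move=> Z ZX; apply/eqP; rewrite -subr_eq0; apply/eqP.
  apply: (@opn_geometric _ (2 * opn Z * K) _ r01) => n.
  have -> : Z * L - L * Z = Z * (L - y n) - (L - y n) * Z.
    by rewrite mulrBr mulrBl (yC _ n ZX) opprB addrA subrK.
  rewrite (le_trans (opnB _ _))//.
  rewrite (le_trans (lerD (opnM _ _) (opnM _ _)))//.
  by have := HL' n; have := opn_ge0 Z; nra.
Qed.

End OperatorAlgebra.

(** * Positivity expressed by norms *)

Section Positivity.
Context {R : realType} {A : cstarAlgType R} {V : banachInnerModType A}.
Implicit Types (S T X Y Z P G b h : 'L(V)) (c t e m : R).
Local Notation "a %:L" := (constL (V := V) a)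
  (at level 1, left associativity, format "a %:L").

Lemma invertibleM S T : invertibleL S -> invertibleL T -> invertibleL (S * T).
Proof.
move=> [S' [S'S SS']] [T' [T'T TT']]; exists (T' * S'); split.
  by rewrite -mulrA (mulrA S') S'S mul1r.
by rewrite -mulrA (mulrA T) TT' mul1r.
Qed.

Lemma comm_inv Z T S : S * T = 1 -> T * S = 1 -> GRing.comm Z T ->
  GRing.comm Z S.
Proof.
move=> ST TS ZT; rewrite /GRing.comm -[LHS]mul1r -ST -!mulrA (mulrA T) -ZT.
by rewrite -(mulrA Z) TS mulr1.
Qed.

Lemma sa_inv T S : S * T = 1 -> T * S = 1 -> sa T -> sa S.
Proof.
move=> ST TS sT; have TS' : T * adj S = 1 by rewrite -{1}sT -adjM ST adj1.
by rewrite /sa -[LHS]mul1r -ST -mulrA TS' mulr1.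
Qed.

(** Positivity with invertibility, in terms of the norm alone: [P = t (1 - X)] with [|X| < 1], the
    form that [neumann] and [sqrt1B] accept. *)
Definition spos P := sa P /\ exists t, 0 < t /\ opn (t%:L - P) < t.

Lemma spos_scale P t : 0 < t -> opn (t%:L - P) < t ->
  opn (1 - t^-1%:L * P) < 1 /\ P = t%:L * (1 - (1 - t^-1%:L * P)).
Proof.
move=> t0 Pt; have tV : t%:L * t^-1%:L = 1 by rewrite constLV ?gt_eqF.
split; last by rewrite opprB addrC subrK mulrA tV mul1r.
have -> : 1 - t^-1%:L * P = t^-1%:L * (t%:L - P).
  by rewrite mulrBr (constLC t^-1 t%:L) tV.
rewrite (le_lt_trans (opn_constM _ _))// ger0_norm ?invr_ge0 1?ltW//.
by rewrite mulrC ltr_pdivrMr// mul1r.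
Qed.

(** A rescaled root of [1 - X]. The bound [opn Y <= opn X] of [sqrt1B] makes the root satisfy [spos]
    again, so that roots can be iterated. *)
Lemma spos_sqrt P : spos P ->
  exists S, [/\ spos S, S * S = P & forall Z, GRing.comm Z P -> GRing.comm Z S].
Proof.
move=> [sP [t [t0 Pt]]]; have [X1 PE] := spos_scale t0 Pt.
have sX : sa (1 - t^-1%:L * P).
  by apply: saB sa1 _; apply: saM (sa_constL _) sP _; exact: constLC.
have [Y [sY Y1 YE Yc]] := sqrt1B sX X1.
have s0 : 0 < Num.sqrt t by rewrite sqrtr_gt0.
exists ((Num.sqrt t)%:L * (1 - Y)); split.
- split; first by apply: saM (sa_constL _) (saB sa1 sY) _; exact: constLC.
  exists (Num.sqrt t); split=> //.
  rewrite mulrBr mulr1 opprB addrC subrK (le_lt_trans (opn_constM _ _))//.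
  by rewrite ger0_norm ?sqrtr_ge0// gtr_pMr// (le_lt_trans Y1).
- rewrite [RHS]PE -YE -mulrA (mulrA (1 - Y)) -(constLC _ (1 - Y)) !mulrA.
  by rewrite -constLM -expr2 sqr_sqrtr// ltW.
- move=> Z ZP; apply: commrM; first exact: commr_constL.
  apply: commrB; first exact: commr1.
  apply: Yc; apply: commrB; first exact: commr1.
  by apply: commrM => //; exact: commr_constL.
Qed.

Lemma spos_inv P : spos P -> invertibleL P.
Proof.
move=> [sP [t [t0 Pt]]]; have [X1 ->] := spos_scale t0 Pt.
apply: invertibleM (neumann X1).
exists t^-1%:L; rewrite -(constLC t); split; exact: constLV (lt0r_neq0 t0).
Qed.

Lemma spos_addc P c : 0 <= c -> spos P -> spos (P + c%:L).
Proof.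
move=> c0 [sP [t [t0 Pt]]]; split; first exact: saD sP (sa_constL _).
exists (t + c); split; first by rewrite ltr_wpDr.
rewrite constLD opprD addrACA subrr addr0 (lt_le_trans Pt)//.
by rewrite lerDl.
Qed.

(* [x + iy] is normal with [(x + iy)^* (x + iy) = x^2 + y^2]. *)
Lemma opn_sqr_comm X Y : sa X -> sa Y -> GRing.comm X Y ->
  opn X ^+ 2 <= opn (X * X + Y * Y).
Proof.
move=> sX sY XY; pose T := X + 'i *: Y.
have aT : adj T = X - 'i *: Y by rewrite adjD adjZ sX sY conjCi scaleNr.
have -> : X * X + Y * Y = adj T * T.
  rewrite aT mulrDl mulrDr mulrDr mulNr mulNr -!scaleLAr -!scaleLAl scalerA.
  have -> : 'i * 'i = -1 :> R[i] by rewrite -expr2 sqrCi.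
  by rewrite scaleN1r XY; abel.
have XT : opn X <= opn T.
  have -> : X = 2^-1%:L * (T + adj T).
    have -> : T + adj T = X + X by rewrite aT /T; abel.
    rewrite -[X in X + X]mul1r -mulrDl -constL1 -constLD mulrA -constLM.
    by rewrite mulVf ?pnatr_eq0// constL1 mul1r.
  rewrite (le_trans (opn_constM _ _))// ger0_norm ?invr_ge0//.
  by have := opnD T (adj T); rewrite opn_adj; lra.
by rewrite (le_trans _ (opn_sqr T))// ler_pXn2r// nnegrE opn_ge0.
Qed.

Lemma spos_subsqr G t : sa G -> opn G ^+ 2 < t -> spos (t%:L - G * G).
Proof.
move=> sG Gt; split; first by apply: saB (sa_constL _) _; exact: saM.
exists t; split; first by rewrite (le_lt_trans _ Gt)// exprn_ge0 ?opn_ge0.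
by rewrite opprB addrC subrK sa_opn_sqr.
Qed.

(** If [W^2 = t - G^2], then [W^2 + G^2 = t], and [opn_sqr_comm] bounds [|W|^2 = |t - G^2|] by
    [t]. *)
Lemma opn_subsqr G t : sa G -> opn G ^+ 2 < t -> opn (t%:L - G * G) <= t.
Proof.
move=> sG Gt; have t0 : 0 < t by rewrite (le_lt_trans _ Gt)// exprn_ge0 ?opn_ge0.
have [W [[sW _] WW Wc]] := spos_sqrt (spos_subsqr sG Gt).
have GW : GRing.comm G W.
  apply: Wc; apply: commrB; first exact: commr_constL.
  by apply: commrM; exact: commr_refl.
rewrite -WW sa_opn_sqr// (le_trans (opn_sqr_comm sW sG (commr_sym GW)))//.
by rewrite WW subrK (le_trans (opn_const _))// ger0_norm// ltW.
Qed.

Lemma spos_1Dsqr G : sa G -> spos (1 + G * G).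
Proof.
move=> sG; split; first by apply: saD sa1 _; exact: saM.
have G0 : 0 <= opn G ^+ 2 by rewrite exprn_ge0 ?opn_ge0.
(* With [t = |G|^2 + 2] the difference [t - (1 + G^2)] is [(|G|^2 + 1) - G^2], of norm at most
   [|G|^2 + 1 < t]. *)
exists (opn G ^+ 2 + 1 + 1); split; first by lra.
have -> : (opn G ^+ 2 + 1 + 1)%:L - (1 + G * G) = (opn G ^+ 2 + 1)%:L - G * G.
  by rewrite [in LHS]constLD constL1; abel.
by rewrite (le_lt_trans (opn_subsqr sG _)) ?ltrDl.
Qed.

(** The closed counterpart of [spos]: for self-adjoint [P], a spectrum inside [[0, 2t]]. In this
    form the triangle inequality gives additivity. *)
Definition pos P := sa P /\ exists t, 0 <= t /\ opn (t%:L - P) <= t.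

Lemma posD S T : pos S -> pos T -> pos (S + T).
Proof.
move=> [sS [s [s0 Ss]]] [sT [t [t0 Tt]]]; split; first exact: saD.
exists (s + t); split; first exact: addr_ge0.
by rewrite constLD opprD addrACA (le_trans (opnD _ _))// lerD.
Qed.

Lemma pos_spos P e : 0 < e -> pos P -> spos (P + e%:L).
Proof.
move=> e0 [sP [t [t0 Pt]]]; split; first exact: saD sP (sa_constL _).
exists (t + e); split; first by rewrite ltr_wpDl.
by rewrite constLD opprD addrACA subrr addr0 (le_lt_trans Pt)// ltrDl.
Qed.

(* If [v^2 = m + h] and [w^2 = m - h] then [h^2 + (vw)^2 = m^2]. *)
Lemma pos_bound h m : sa h -> 0 <= m -> pos (m%:L + h) -> pos (m%:L - h) ->
  opn h <= m.
Proof.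
move=> sh m0 p1 p2; apply/ler_addgt0Pr => e e0.
have [v [[sv _] vv vc]] := spos_sqrt (pos_spos e0 p1).
have [w [[sw _] ww wc]] := spos_sqrt (pos_spos e0 p2).
have hc T : GRing.comm T h -> GRing.comm T (m%:L + h + e%:L) /\
    GRing.comm T (m%:L - h + e%:L).
  move=> Th; split; apply: commrD (commr_constL _ _).
    by apply: commrD Th; exact: commr_constL.
  by apply: commrB Th; exact: commr_constL.
have [hv hw] : GRing.comm h v /\ GRing.comm h w.
  by have [c1 c2] := hc h (commr_refl h); split; [apply: vc|apply: wc].
have vw : GRing.comm v w by apply: wc; case: (hc v (commr_sym hv)).
have me0 : 0 <= m + e by rewrite addr_ge0// ltW.
rewrite -(@ler_pXn2r _ 2) ?nnegrE ?opn_ge0//.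
rewrite (le_trans (opn_sqr_comm sh (saM sv sw vw) (commrM hv hw)))//.
have -> : h * h + v * w * (v * w) = ((m + e) ^+ 2)%:L.
  have -> : v * w * (v * w) = (v * v) * (w * w).
    by rewrite -!mulrA; congr (_ * _); rewrite !mulrA vw.
  rewrite vv ww constLX constLD expr2.
  have := commr_constL m h; have := commr_constL e h; have := constLC m e%:L.
  rewrite /GRing.comm => H1 H2 H3.
  by rewrite !(mulrDl, mulrDr, mulrN, mulNr) H2 H3; abel.
by rewrite (le_trans (opn_const _))// ger0_norm// exprn_ge0.
Qed.

(** Both [m + (S - T) = S + (m - T)] and [m - (S - T) = T + (m - S)] are sums of positive operators,
    so [pos_bound] applies. *)
Lemma pos_diff S T m : pos S -> pos T -> opn S <= m -> opn T <= m ->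
  opn (S - T) <= m.
Proof.
move=> pS pT Sm Tm; have m0 : 0 <= m := le_trans (opn_ge0 _) Sm.
have sub P : pos P -> opn P <= m -> pos (m%:L - P).
  move=> [sP _] Pm; split; first exact: saB (sa_constL _) sP.
  by exists m; split=> //; rewrite opprB addrC subrK.
apply: pos_bound => //; first by apply: saB; [case: pS|case: pT].
  have -> : m%:L + (S - T) = S + (m%:L - T) by abel.
  exact/posD/sub.
have -> : m%:L - (S - T) = T + (m%:L - S) by abel.
exact/posD/sub.
Qed.

(* If [|b|^2 - b^2] were invertible, its inverse would be bounded, and for some
   small e > 0 there would be a self-adjoint y commuting with b such that
   [b^2 + y^2 = |b|^2 - e], contradicting [|b|^2 <= |b^2 + y^2|]. *)
Lemma opn_sqr_spectrum b : sa b -> 0 < opn b ->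
  ~ invertibleL ((opn b ^+ 2)%:L - b * b).
Proof.
move=> sb b0 [rho [rhoT Trho]].
set B := opn b ^+ 2 in rhoT Trho; have B0 : 0 < B by rewrite exprn_gt0.
pose N := opn rho; have N0 : 0 <= N := opn_ge0 _.
(* [e (4N + 1) <= 1] will give [|w^-2| < (2e)^-1], so that [(2e)^-1 - w^-2] has a root [s]; [e <= B]
   keeps [B - e] nonnegative. *)
pose e := Num.min B (4 * N + 1)^-1.
have N1 : 0 < 4 * N + 1 by lra.
have e0 : 0 < e by rewrite lt_min B0 invr_gt0.
have eB : e <= B by rewrite ge_min lexx.
have eN : e * (4 * N + 1) <= 1.
  by rewrite -ler_pdivlMr// mul1r ge_min lexx orbT.
have Be : B < B + e by rewrite ltrDl.
have [w [pw ww wc]] := spos_sqrt (spos_subsqr sb Be).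
have [v [vw wv]] := spos_inv pw; have sw : sa w := pw.1.
have sv : sa v := sa_inv vw wv sw.
have bT : GRing.comm b ((B + e)%:L - b * b).
  by apply: commrB; [exact: commr_constL|apply: commrM; exact: commr_refl].
have bw := wc _ bT; have bv := comm_inv vw wv bw.
have vwc : GRing.comm w v by rewrite /GRing.comm vw wv.
pose M := opn (v * v); have M0 : 0 <= M := opn_ge0 _.
have MN : M <= N + e * (M * N).
  (* The resolvent identity for [w^2 = (B - b^2) + e], with [v] inverse to [w]. *)
  have vE : v * v = rho - e%:L * (v * v * rho).
    have H : v * v * (w * w) = 1 by rewrite mulrA -(mulrA v) vw mulr1 vw.
    rewrite -[LHS]mulr1 -Trho mulrA.
    have -> : B%:L - b * b = w * w - e%:L by rewrite ww constLD; abel.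
    by rewrite mulrBr H mulrBl mul1r -(constLC e (v * v)) -!mulrA.
  rewrite /M {1}vE (le_trans (opnB _ _))// lerD// (le_trans (opn_constM _ _))//.
  by rewrite gtr0_norm// ler_wpM2l ?opnM// ltW.
have vk : opn v ^+ 2 < (2 * e)^-1.
  have e2 : 0 < 2 * e by lra.
  rewrite -sa_opn_sqr// -/M -[ltRHS]mul1r ltr_pdivlMr//; nra.
have [s [[ss _] sE sc]] := spos_sqrt (spos_subsqr sv vk).
have vvc T : GRing.comm T v -> GRing.comm T s.
  move=> Tv; apply: sc; apply: commrB; first exact: commr_constL.
  exact: commrM.
have bs := vvc _ bv; have ws := vvc _ vwc.
(* As [s^2 = (2e)^-1 - w^-2], this gives [y^2 = w^2 - 2e = (B - e) - b^2]. *)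
pose y := (Num.sqrt (2 * e))%:L * (s * w).
have sy : sa y.
  apply: saM (sa_constL _) _ (constLC _ _); apply: saM => //; exact: commr_sym.
have by_ : GRing.comm b y.
  by apply: commrM; [exact: commr_constL|exact: commrM].
have yy : y * y = (B + e - 2 * e)%:L - b * b.
  rewrite /y -mulrA (mulrA (s * w)) -(constLC _ (s * w)) !mulrA -constLM.
  rewrite -expr2 sqr_sqrtr; last by lra.
  have -> : (2 * e)%:L * s * w * s * w = (2 * e)%:L * ((s * s) * (w * w)).
    by rewrite !mulrA -(mulrA _ w s) ws !mulrA.
  have -> : s * s * (w * w) = (2 * e)^-1%:L * (w * w) - 1.
    rewrite sE mulrBl; congr (_ - _).
    by rewrite mulrA -(mulrA v) vw mulr1 vw.
  rewrite mulrBr mulr1 (mulrA (2 * e)%:L) constLV ?mul1r; last by rewrite gt_eqF//; lra.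
  by rewrite ww [in RHS]constLB; abel.
have := opn_sqr_comm sb sy by_; rewrite yy addrC subrK -/B.
have := opn_const (V := V) (B + e - 2 * e).
by rewrite ger0_norm; lra.
Qed.

(** Put [b = t - T] with [t = |T| + 1]. If [|b| > t], both factors of
    [|b|^2 - b^2 = (|b| - b) (|b| + b)] are invertible: the first is [T + (|b| - t)], the second
    satisfies [spos]. This contradicts [opn_sqr_spectrum]. *)
Lemma pos_of_spectrum T : sa T ->
  (forall k, 0 < k -> invertibleL (T + k%:L)) -> pos T.
Proof.
move=> sT inv; split=> //; pose t := opn T + 1.
have t0 : 0 < t by have := opn_ge0 T; rewrite /t; lra.
exists t; split; first exact: ltW.
rewrite leNgt; apply/negP => tb; pose b := t%:L - T.
rewrite -/b in tb; have TE : T = t%:L - b by rewrite /b; abel.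
have sb : sa b by exact: saB (sa_constL _) sT.
apply: (opn_sqr_spectrum sb); first exact: lt_trans tb.
have -> : (opn b ^+ 2)%:L - b * b =
    (T + (opn b - t)%:L) * ((opn b + t)%:L - T).
  clearbody b; have -> : T + (opn b - t)%:L = (opn b)%:L - b.
    by rewrite constLB TE; abel.
  have -> : (opn b + t)%:L - T = (opn b)%:L + b by rewrite constLD TE; abel.
  have := constLC (opn b) b; rewrite /GRing.comm => cb.
  by rewrite constLX expr2 mulrBl !mulrDr cb; abel.
apply: invertibleM; first by apply: inv; rewrite subr_gt0.
apply: spos_inv; split; first exact: saB (sa_constL _) sT.
exists (opn b + t); split; first by rewrite addr_gt0// (lt_trans t0).
by rewrite opprB addrC subrK /t; have := opn_ge0 b; lra.
Qed.

End Positivity.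
(** * The Cauchy-Schwarz inequality *)

Section CStarNorm.
Context {R : realType} {A : cstarAlgType R}.
Implicit Types a b : A.

Lemma nrm_cmul a b : nrm (cmul a b) <= nrm a * nrm b.
Proof. by rewrite -nrm_le rmorphM /= -!nrmE cnormM_le. Qed.

Lemma nrm_star_mul a : nrm (cmul (cstar a) a) = nrm a ^+ 2.
Proof. by apply: complexI; rewrite rmorphXn /= -!nrmE cnorm_star. Qed.

Lemma nrm_cstar a : nrm (cstar a) = nrm a.
Proof.
suff le (c : A) : nrm c <= nrm (cstar c).
  by apply/eqP; rewrite eq_le le andbT -{2}(cstarK a) le.
have := nrm_ge0 c; rewrite le_eqVlt => /predU1P[<-|c0]; first exact: nrm_ge0.
by rewrite -(ler_pM2r c0) -expr2 -nrm_star_mul nrm_cmul.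
Qed.

Lemma cmulNl a b : cmul (- a) b = - cmul a b.
Proof. by rewrite -scaleN1r cmulZl scaleN1r. Qed.

End CStarNorm.

(* A as a Hilbert module over itself.  Its form is not yet known to be positive,
   but the operators [a + k] on it model the unitization of A. *)
Definition regmod (R : realType) (A : cstarAlgType R) : Type := A.

Section RegularModule.
Context {R : realType} {A : cstarAlgType R}.

HB.instance Definition _ := GRing.Lmodule.on (regmod A).

Let ra (x : regmod A) (a : A) : regmod A := cmul (x : A) a.
Let inn (x y : regmod A) : A := cmul (cstar (x : A)) (y : A).

Fact regmod_ractM x a b : ra x (cmul a b) = ra (ra x a) b.
Proof. exact: cmulA. Qed.
Fact regmod_ractDl x y a : ra (x + y) a = ra x a + ra y a.
Proof. exact: cmulDl. Qed.
Fact regmod_ractDr x a b : ra x (a + b) = ra x a + ra x b.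
Proof. exact: cmulDr. Qed.
Fact regmod_ractZl (k : R[i]) x a : ra (k *: x) a = k *: ra x a.
Proof. exact: cmulZl. Qed.
Fact regmod_ractZr (k : R[i]) x a : ra x (k *: a) = k *: ra x a.
Proof. exact: cmulZr. Qed.
Fact regmod_innerDr x y z : inn x (y + z) = inn x y + inn x z.
Proof. exact: cmulDr. Qed.
Fact regmod_innerZr (k : R[i]) x y : inn x (k *: y) = k *: inn x y.
Proof. exact: cmulZr. Qed.
Fact regmod_innerAr x y a : inn x (ra y a) = cmul (inn x y) a.
Proof. exact: cmulA. Qed.
Fact regmod_inner_star x y : cstar (inn x y) = inn y x.
Proof. by rewrite /inn cstarM cstarK. Qed.

HB.instance Definition _ := Lmodule_isInnerModule.Build R A (regmod A)
  regmod_ractM regmod_ractDl regmod_ractDr regmod_ractZl regmod_ractZr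
  regmod_innerDr regmod_innerZr regmod_innerAr regmod_inner_star.

Lemma regmod_inrm (x : regmod A) : inrm x = nrm (x : A).
Proof. by rewrite /inrm nrm_star_mul sqrtr_sqr ger0_norm// nrm_ge0. Qed.

Fact regmod_nrm_inner (x y : regmod A) : nrm (inner x y : A) <= inrm x * inrm y.
Proof. by rewrite !regmod_inrm (le_trans (nrm_cmul _ _))// nrm_cstar. Qed.

Fact regmod_inner_eq0 (x : regmod A) : (inner x x : A) = 0 -> x = 0.
Proof.
move=> x0; apply: (@nrm_eq0 _ A); apply/eqP; rewrite -sqrf_eq0 -nrm_star_mul.
by rewrite [cmul _ _]x0 nrm0.
Qed.

Fact regmod_complete (u : nat -> regmod A) (d : nat -> R) (r : R) :
  0 <= r < 1 -> (forall n, d n.+1 <= r * d n) ->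
  (forall n, inrm (u n.+1 - u n) <= d n) ->
  exists l, forall n, inrm (l - u n) <= d n / (1 - r).
Proof.
move=> r01 dr ud; have [|l Hl] := @complete_geometric R A u d r r01 dr.
  by move=> n; rewrite -regmod_inrm.
by exists l => n; rewrite regmod_inrm.
Qed.

HB.instance Definition _ := InnerModule_isBanach.Build R A (regmod A)
  regmod_nrm_inner regmod_inner_eq0 regmod_complete.

Fact lmulL_subproof (a : A) :
  exists S, @adjoint_of _ _ (regmod A) (regmod A) (fun x => cmul a (x : A)) S.
Proof.
exists (fun x : regmod A => cmul (cstar a) (x : A)) => x y.
by rewrite /inner /= /inn cstarM cmulA.
Qed.
Definition lmulL (a : A) : 'L(regmod A) := AdjOp (lmulL_subproof a).

Implicit Types a b : A.

Lemma adj_lmulL a : adj (lmulL a) = lmulL (cstar a).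
Proof.
by apply: adj_eq => x y /=; rewrite /inner /= /inn cstarM cmulA.
Qed.

Lemma lmulLD a b : lmulL (a + b) = lmulL a + lmulL b.
Proof. by apply: adjop_ext => x /=; rewrite cmulDl. Qed.

Lemma lmulLN a : lmulL (- a) = - lmulL a.
Proof. by apply: adjop_ext => x /=; rewrite cmulNl. Qed.

Lemma lmulLM a b : lmulL (cmul a b) = lmulL a * lmulL b.
Proof. by apply: adjop_ext => x; rewrite mulLE /= cmulA. Qed.

Lemma opn_lmulL a : opn (lmulL a) = nrm a.
Proof.
apply/eqP; rewrite eq_le; apply/andP; split.
  apply: opn_le => [|x]; first exact: nrm_ge0.
  by rewrite !regmod_inrm nrm_cmul.
have [->|na] := eqVneq (nrm a) 0; first exact: opn_ge0.
have a0 : 0 < nrm a by rewrite lt_neqAle eq_sym na nrm_ge0.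
have := opnP (lmulL a) (cstar a : regmod A); rewrite !regmod_inrm /=.
rewrite -{1}(cstarK a) nrm_star_mul nrm_cstar expr2.
by rewrite ler_pM2r.
Qed.

(** No [-k] with [k > 0] is in the spectrum, so [c = - a / k] is quasi-invertible, and
    [a + k = k (1 - c)] is invertible among the operators on [regmod A]. *)
Lemma cpositive_pos a : cpositive a -> pos (lmulL a).
Proof.
move=> [sta spa]; apply: pos_of_spectrum; first by rewrite /sa adj_lmulL sta.
move=> k k0; have k0' : (- k%:C%C : R[i]) != 0.
  by rewrite oppr_eq0 (_ : 0 = (0 : R)%:C%C)// (inj_eq (@complexI _)) gt_eqF.
have /contrapT[b [ab ba]] : ~ ~ quasi_invertible ((- k%:C%C)^-1 *: a).
  move=> nq; have : spectrum a (- k%:C%C) by right.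
  by move/spa; rewrite oppr_ge0 lecE /= eqxx leNgt k0.
set c := (- k%:C%C)^-1 *: a in ab ba.
have -> : lmulL a + constL k = constL k * (1 - lmulL c).
  have -> : lmulL a = - (constL k * lmulL c).
    apply: adjop_ext => x; rewrite /= cmulZl scalerA.
    by rewrite -[X in X / _]opprK mulNr (divff k0') scaleN1r opprK.
  by rewrite mulrBr mulr1 addrC.
apply: invertibleM.
  by exists (constL k^-1); rewrite -(constLC k); split; apply/constLV/lt0r_neq0.
(* The equations [b + c = b c = c b] say that [1 - b] inverts [1 - c]. *)
exists (1 - lmulL b); split.
  rewrite mulrBl mul1r mulrBr mulr1 -lmulLM -ba lmulLD; abel.
rewrite mulrBl mul1r mulrBr mulr1 -lmulLM -ab lmulLD; abel.
Qed.

End RegularModule.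
Section CauchySchwarz.
Context {R : realType} {A : cstarAlgType R}.
Implicit Types p q : A.

Lemma cpositive_nrmB p q (m : R) : cpositive p -> cpositive q ->
  nrm p <= m -> nrm q <= m -> nrm (p - q) <= m.
Proof.
move=> /cpositive_pos pp /cpositive_pos pq.
by rewrite -!opn_lmulL lmulLD lmulLN; exact: pos_diff.
Qed.

Lemma cpositive_anti p : cpositive p -> cpositive (- p) -> p = 0.
Proof.
move=> /cpositive_pos pp /cpositive_pos pn; apply: nrm_eq0; apply/eqP.
rewrite eq_le nrm_ge0 andbT -opn_lmulL; apply: pos_bound => //.
- by case: pp.
- by rewrite constL0 add0r.
- by rewrite constL0 add0r -lmulLN.
Qed.

Variable H : hilbertModType A.
Implicit Types x y : H.

Lemma hilbert_inrm x : inrm x = nrm x.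
Proof.
rewrite /inrm -[RHS]ger0_norm ?nrm_ge0// -sqrtr_sqr; congr Num.sqrt.
by apply: complexI; rewrite rmorphXn /= -!nrmE hnormE sqrtCK.
Qed.

Lemma nrm_hilbert_inner_xx x : nrm (inner x x : A) = nrm x ^+ 2.
Proof. by rewrite -hilbert_inrm sqr_sqrtr// nrm_ge0. Qed.

(* [<x + ty, x + ty> - <x - ty, x - ty> = 4t <x, y>] is a difference of two
   positive elements of norm at most [(|x| + t|y|)^2]; take [t = |x| / |y|]. *)
Lemma nrm_inner_selfadjoint x y : inner x y = (inner y x : A) ->
  nrm (inner x y : A) <= nrm x * nrm y.
Proof.
move=> xy; have [/nrm_eq0 ->|x0] := eqVneq (nrm x) 0.
  by rewrite inner0l !nrm0 mul0r.
have [/nrm_eq0 ->|y0] := eqVneq (nrm y) 0.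
  by rewrite inner0r !nrm0 mulr0.
have {}x0 : 0 < nrm x by rewrite lt_neqAle eq_sym x0 nrm_ge0.
have {}y0 : 0 < nrm y by rewrite lt_neqAle eq_sym y0 nrm_ge0.
pose t := nrm x / nrm y; have t0 : 0 < t by rewrite divr_gt0.
pose ty := t%:C%C *: y.
have tyn : nrm ty = nrm x by rewrite nrmZr gtr0_norm// divfK// gt_eqF.
have bound (z : H) : nrm z <= nrm x + nrm ty ->
    nrm (inner z z : A) <= 4 * nrm x ^+ 2.
  move=> zx; rewrite nrm_hilbert_inner_xx.
  by move: zx (nrm_ge0 z); rewrite tyn; nra.
have xty : nrm (x - ty) <= nrm x + nrm ty by rewrite -[nrm ty]nrmN nrmD.
have := cpositive_nrmB (inner_ge0 (x + ty)) (inner_ge0 (x - ty))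
  (bound _ (nrmD _ _)) (bound _ xty).
have -> : inner (x + ty) (x + ty) - inner (x - ty) (x - ty) =
    (4 * t)%:C%C *: (inner x y : A).
  have tyx : inner x ty = t%:C%C *: inner x y :> A by rewrite innerZr.
  have ytx : inner ty x = t%:C%C *: inner x y :> A.
    by rewrite innerZl -xy conj_Creal// complex_real.
  rewrite !(innerDl, innerDr, innerNl, innerNr) tyx ytx.
  have -> : 4 * t = t + t + (t + t) by ring.
  by rewrite !rmorphD !scalerDl; abel.
have t4 : 0 < 4 * t by rewrite mulr_gt0.
rewrite nrmZr gtr0_norm// => /(ler_wpM2r (ltW y0)) le4.
have tn : t * nrm y = nrm x by rewrite divfK// gt_eqF.
rewrite -(ler_pM2l x0) -[X in X * nrm (inner x y)]tn.
by clearbody t; lra.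
Qed.

(** With [a = <x, y>], replacing [y] by [y' = ract y (cstar a)] makes the inner product
    self-adjoint, of norm [|a|^2], while [|y'| <= |y| |a|]. The self-adjoint case gives the bound
    after division by [|a|]. *)
Lemma nrm_hilbert_inner x y : nrm (inner x y : A) <= inrm x * inrm y.
Proof.
rewrite !hilbert_inrm; set a : A := inner x y.
have [->|na] := eqVneq (nrm a) 0; first by rewrite mulr_ge0 ?nrm_ge0.
have a0 : 0 < nrm a by rewrite lt_neqAle eq_sym na nrm_ge0.
pose y' := ract y (cstar a).
have xy' : inner x y' = cmul a (cstar a) by rewrite innerAr.
have y'n : nrm y' <= nrm y * nrm a.
  rewrite -(@ler_pXn2r _ 2) ?nnegrE ?mulr_ge0 ?nrm_ge0//.
  rewrite -nrm_hilbert_inner_xx innerAr innerAl cstarK exprMn.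
  rewrite (le_trans (nrm_cmul _ _))// nrm_cstar (expr2 (nrm a)) mulrA.
  rewrite ler_wpM2r ?nrm_ge0// (le_trans (nrm_cmul _ _))//.
  by rewrite nrm_hilbert_inner_xx mulrC.
rewrite -(ler_pM2r a0) -mulrA (le_trans _ (ler_wpM2l (nrm_ge0 x) y'n))//.
rewrite -expr2 -[X in X ^+ 2]nrm_cstar -nrm_star_mul cstarK -xy'.
apply: nrm_inner_selfadjoint.
by rewrite -[RHS]inner_star xy' cstarM cstarK.
Qed.

End CauchySchwarz.

(** * Hilbert modules as complete inner modules *)

Section HilbertBanach.
Context {R : realType} {A : cstarAlgType R} (H : hilbertModType A).

Fact hilbert_complete (u : nat -> H) (d : nat -> R) (r : R) :
  0 <= r < 1 -> (forall n, d n.+1 <= r * d n) ->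
  (forall n, inrm (u n.+1 - u n) <= d n) ->
  exists l, forall n, inrm (l - u n) <= d n / (1 - r).
Proof.
move=> r01 dr ud; have [|l Hl] := @complete_geometric R H u d r r01 dr.
  by move=> n; rewrite -hilbert_inrm.
by exists l => n; rewrite hilbert_inrm.
Qed.

HB.instance Definition _ := InnerModule_isBanach.Build R A H
  (@nrm_hilbert_inner R A H) (@inner_eq0 R A H) hilbert_complete.

End HilbertBanach.

(** * Uniqueness of the chosen operators *)

Section SquareRoots.
Context {R : realType} {A : cstarAlgType R} {H : hilbertModType A}.
Implicit Types (S T P Z D r : 'L(H)).

Lemma adjM_eq0 T : adj T * T = 0 -> T = 0.
Proof.
move=> T0; apply: opn_eq0; rewrite -(@ler_pXn2r _ 2) ?nnegrE ?opn_ge0// expr0n.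
by rewrite (le_trans (opn_sqr T))// T0 opn_le// => x; rewrite inrm0 mul0r.
Qed.

(** Polarization: [x + y] and [x + 'i *: y] make the sum and the difference of [<x, Ty>] and
    [<y, Tx>] vanish. *)
Lemma inner_op_eq0 T : (forall x : H, (inner x (T x) : A) = 0) -> T = 0.
Proof.
move=> T0; apply: adjop_ext => y; apply: inner_inj => x.
have two (a : A) : a + a = 0 -> a = 0.
  move=> aa; apply: (@scalerI _ _ 2); rewrite ?pnatr_eq0//.
  by rewrite scaler_nat mulr2n aa scaler0.
have H1 : inner x (T y) + inner y (T x) = 0 :> A.
  have := T0 (x + y).
  by rewrite opD innerDl !innerDr !T0 add0r addr0.
have H2 : inner x (T y) - inner y (T x) = 0 :> A.
  have := T0 (x + 'i *: y).
  rewrite opD opZ innerDl !innerDr !innerZl !innerZr !T0 !scaler0 add0r addr0.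
  rewrite conjCi scaleNr -scalerBr => /eqP.
  by rewrite scaler_eq0 (negPf (neq0Ci _)) => /eqP.
have -> : inner (T y) x = cstar (inner x (T y) : A) by rewrite inner_star.
have -> : inner x (T y) = 0 :> A.
  by apply: two; rewrite -[RHS](addr0 0) -{1}H1 -H2; abel.
by rewrite -[0 in LHS](inner0l x) inner_star inner0r inner0l.
Qed.

Lemma positiveL_sa T : positiveL T -> sa T.
Proof.
move=> pT; apply/esym/eqP; rewrite -subr_eq0; apply/eqP/inner_op_eq0 => x.
rewrite /= innerDr innerNr -(inner_adj T) -(inner_star x (T x)).
by have [-> _] := pT x; rewrite subrr.
Qed.

Lemma sqr_positive r : sa r -> positiveL (r * r).
Proof. by move=> sr x; rewrite mulLE /= -{1}sr -inner_adj; exact: inner_ge0. Qed.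

(* With [D = r^2 - S] the positive elements [D r^2 D] and [D S D] add up to 0,
   hence vanish, so that [D^3 = 0]. *)
Lemma positive_sqrt_uniq r S : sa r -> positiveL S ->
  GRing.comm (r * r) S -> r * r * (r * r) = S * S -> S = r * r.
Proof.
move=> sr pS rS rrS; have sS := positiveL_sa pS.
pose T := r * r; have pT : positiveL T := sqr_positive sr.
have sT := positiveL_sa pT; rewrite -/T in rS rrS *.
pose D := T - S; have sD : sa D := saB sT sS.
have TSD : (T + S) * D = 0 by rewrite /D mulrDl !mulrBr rrS rS; abel.
have DE : D = T - S by []; clearbody D T.
have sum0 (x : H) : inner (D x) (T (D x)) + inner (D x) (S (D x)) = 0 :> A.
  by rewrite -innerDr -[T _ + _]/(((T + S) * D) x) TSD inner0r.
have zero (a b : A) : cpositive a -> cpositive b -> a + b = 0 -> a = 0.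
  move=> pa pb ab; apply: cpositive_anti => //.
  by rewrite -[- a]add0r -ab addrC addKr.
have DTD : D * T * D = 0.
  apply: inner_op_eq0 => x; rewrite !mulLE /= -{1}sD -inner_adj.
  exact: zero (pT _) (pS _) (sum0 x).
have DSD : D * S * D = 0.
  apply: inner_op_eq0 => x; rewrite !mulLE /= -{1}sD -inner_adj.
  by apply: zero (pS _) (pT _) _; rewrite addrC.
have D3 : D * D * D = 0 by rewrite {2}DE mulrBr mulrBl DTD DSD subrr.
have D2 : D * D = 0.
  by apply: adjM_eq0; rewrite adjM sD mulrA D3 mul0r.
have D1 : D = 0 by apply: adjM_eq0; rewrite sD.
by apply/eqP; rewrite eq_sym -subr_eq0 -DE D1.
Qed.

(** [T^2 = r^4 P] forces [T] to vanish on the kernel of [P] and to commute with [r^4], hence with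
    [r^2]. Then [positive_sqrt_uniq] applies to the self-adjoint [r P], whose square is [r^2 P]. *)
Lemma projection_sqrt_uniq r P T : sa r ->
  (forall Z, GRing.comm Z (r * r * (r * r)) -> GRing.comm Z (r * r)) ->
  sa P -> P * P = P -> GRing.comm P r ->
  positiveL T -> T * T = r * r * (r * r) * P -> T = r * r * P.
Proof.
move=> sr bic sP PP Pr pT TT; have sT := positiveL_sa pT.
pose S := r * r; rewrite -/S in bic TT *.
have PS : GRing.comm P S by exact: commrM.
have SE : S = r * r by []; clearbody S.
have TP : T * P = T.
  apply/eqP; rewrite -subr_eq0 -opprB oppr_eq0; apply/eqP.
  have -> : T - T * P = T * (1 - P) by ncring.
  apply: adjM_eq0; rewrite adjM sT adjB adj1 sP -mulrA (mulrA T) TT.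
  have -> : S * S * P * (1 - P) = 0 by rewrite mulrBr mulr1 -(mulrA (S * S)) PP subrr.
  by rewrite mulr0.
have PT : P * T = T by rewrite -{1}sT -{1}sP -adjM TP sT.
have TSS : GRing.comm T (S * S).
  have SSP : P * (S * S) = S * S * P by exact: commrM.
  transitivity (T * T * T); first by rewrite -[in LHS]TP -mulrA SSP -TT mulrA.
  by rewrite TT -mulrA PT.
have TS := bic _ TSS.
have srP : sa (r * P) by apply: saM => //; exact: commr_sym.
have rP : r * P * (r * P) = S * P.
  by rewrite -mulrA (mulrA P) Pr -(mulrA r P) PP mulrA SE.
rewrite -rP; apply: positive_sqrt_uniq => //.
  rewrite rP; apply: commr_sym; apply: commrM => //.
  by rewrite /GRing.comm TP PT.
by rewrite rP TT -mulrA (mulrA P) PS -(mulrA S P) PP mulrA.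
Qed.

End SquareRoots.

Section ChosenOperators.
Context {R : realType} {A : cstarAlgType R}.

Lemma the_op_eq (E F : innerModType A) (C : set 'L(E, F)) T :
  C T -> (forall S, C S -> S = T) -> the_op C = T.
Proof. by move=> CT H; apply: xget_unique. Qed.

Lemma invL_eq (E F : innerModType A) (T : 'L(E, F)) (S : 'L(F, E)) :
  (forall x, S (T x) = x) -> (forall y, T (S y) = y) -> invL T = S.
Proof.
move=> ST TS; apply: the_op_eq => [|S' [S'T _]].
  by split; apply: adjop_ext.
apply: adjop_ext => y; rewrite -{1}(TS y).
exact: (congr1 (fun f : 'L(E) => f (S y)) S'T).
Qed.

Variable H : hilbertModType A.
Implicit Types (T X Y P : 'L(H)).

(** [T X] and [T Y] are projections onto the range of [T], hence equal; likewise [X T = Y T]. Then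
    [X = X T X = X T Y = Y T Y = Y]. *)
Lemma moore_penrose_uniq T X Y :
  moore_penrose T X -> moore_penrose T Y -> X = Y.
Proof.
rewrite /moore_penrose -!mulLE.
move=> [TXT XTX sTX sXT] [TYT YTY sTY sYT].
have TXY : T * X = T * Y.
  by rewrite -sTX -{1}TYT -mulrA adjM sTX sTY mulrA TXT.
have XYT : X * T = Y * T.
  by rewrite -sXT -{1}TYT -(mulrA T) mulrA adjM sXT sYT -mulrA (mulrA T) TXT.
by rewrite -XTX -mulrA TXY mulrA XYT YTY.
Qed.

Lemma pinvL_eq T X : moore_penrose T X -> pinvL T = X.
Proof. by move=> TX; apply: the_op_eq => // Y /moore_penrose_uniq; apply. Qed.

(** Projections with the same range absorb each other, [P P' = P'] and [P' P = P]; taking adjoints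
    identifies them. *)
Lemma projL_eq (M : submod H) P :
  P * P = P -> sa P -> range P = submod_set M -> projL M = P.
Proof.
move=> PP sP PM; apply: the_op_eq => // P' [[P'P' sP'] P'M].
have abs (X Y : 'L(H)) : Y * Y = Y -> range X = range Y -> Y * X = X.
  move=> YY XY; apply: adjop_ext => x; rewrite mulLE /=.
  have [y _ <-] : range Y (X x) by rewrite -XY; exists x.
  by rewrite -[Y (Y y)]/((Y * Y) y) YY.
have H1 : P * P' = P' by apply: abs => //; rewrite PM.
have H2 : P' * P = P by apply: abs => //; rewrite PM.
by rewrite -H1 -[P in LHS]sP -sP' -adjM H2.
Qed.

End ChosenOperators.

Lemma sqrtL_projection (R : realType) (A : cstarAlgType R)
    (H : hilbertModType A) (r P : 'L(H)) : sa r ->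
  (forall Z, GRing.comm Z (r * r * (r * r)) -> GRing.comm Z (r * r)) ->
  sa P -> P * P = P -> GRing.comm P r ->
  sqrtL (r * r * (r * r) * P) = r * r * P.
Proof.
move=> sr bic sP PP Pr; apply: the_op_eq => [|T [pT TT]]; last first.
  exact: projection_sqrt_uniq.
have srP : sa (r * P) by apply: saM sr sP (commr_sym Pr).
have rP : r * P * (r * P) = r * r * P.
  by rewrite -mulrA (mulrA P) Pr -(mulrA r P) PP mulrA.
split; first by rewrite -rP; exact: sqr_positive.
have PS : GRing.comm P (r * r) by exact: commrM.
by rewrite -mulLE -mulrA (mulrA P) PS -(mulrA (r * r) P) PP mulrA.
Qed.
(** * Idempotents *)

Section Idempotent.
Context {R : realType} {A : cstarAlgType R} {H : hilbertModType A}.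
Implicit Types (P Q S Z r : 'L(H)).

(* P is the projection onto the range of Q, [r^4 = (Q + Q^* - 1)^2] and
   [d = (r^2 + 1)^-1]. *)
Record idempotent_data Q P r ri d : Prop := IdempotentData {
  id_saP : sa P;
  id_PP : P * P = P;
  id_PQ : P * Q = Q;
  id_QP : Q * P = P;
  id_sar : sa r;
  id_rir : ri * r = 1;
  id_rri : r * ri = 1;
  id_Pr : GRing.comm P r;
  id_d : d * (r * r + 1) = 1;
  id_d' : (r * r + 1) * d = 1;
  id_QQ : Q * adj Q = r * r * (r * r) * P;
  id_bic : forall Z, GRing.comm Z (r * r * (r * r)) -> GRing.comm Z (r * r) }.

Lemma idempotent_dataP Q : Q * Q = Q -> exists P P' r ri d,
  [/\ idempotent_data Q P r ri d, sa P', P' * P' = P',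
      P' * adj Q = adj Q /\ adj Q * P' = P'
    & P * P' * P = ri * ri * (ri * ri) * P].
Proof.
move=> QQ; pose Qs := adj Q.
have QsQs : Qs * Qs = Qs by rewrite /Qs -adjM QQ.
have aQs : adj Qs = Q by rewrite /Qs adjK.
pose K : 'L(H) := 'i *: (Q - Qs).
have sK : sa K by rewrite /sa /K adjZ conjCi adjB aQs -/Qs scaleNr -scalerN opprB.
pose T := 1 + K * K.
have TE : T = Q * Qs + Qs * Q - Q - Qs + 1.
  rewrite /T /K -scaleLAl -scaleLAr scalerA.
  have -> : 'i * 'i = -1 :> R[i] by rewrite -expr2 sqrCi.
  by rewrite scaleN1r !(mulrDl, mulrDr, mulNr, mulrN) QQ QsQs; abel.
have TQ : T * Q = Q * Qs * Q.
  by rewrite TE !(mulrDl, mulNr, mul1r) -(mulrA Qs) QQ; abel.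
have QT : Q * T = Q * Qs * Q.
  by rewrite TE !(mulrDr, mulrN, mulr1) !mulrA QQ; abel.
have TQs : T * Qs = Qs * Q * Qs.
  by rewrite TE !(mulrDl, mulNr, mul1r) -(mulrA Q) QsQs; abel.
have QsT : Qs * T = Qs * Q * Qs.
  by rewrite TE !(mulrDr, mulrN, mulr1) !mulrA QsQs; abel.
(* Two successive roots, so that [S = r^2] is visibly positive and [T = r^4]. *)
have [S [pS SS Sc]] := spos_sqrt (spos_1Dsqr sK).
have [r [pr rr rc]] := spos_sqrt pS.
have [ri [rir rri]] := spos_inv pr.
have [d [dS Sd]] := spos_inv (spos_addc ler01 pS).
rewrite constL1 in dS Sd; rewrite -/T in SS Sc.
have T_S Z : GRing.comm Z T -> GRing.comm Z S := Sc Z.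
have T_r Z : GRing.comm Z T -> GRing.comm Z r by move=> /T_S/rc.
have T_ri Z : GRing.comm Z T -> GRing.comm Z ri.
  by move=> /T_r; exact: comm_inv.
have sr : sa r := pr.1.
have sri : sa ri := sa_inv rir rri sr.
pose V := ri * ri * (ri * ri).
have T_V Z : GRing.comm Z T -> GRing.comm Z V.
  by move=> ZT; do !apply: commrM; exact: T_ri.
have TV : T * V = 1.
  rewrite -SS -rr /V.
  have cancel X Y : r * X * (ri * Y) = r * (X * ri) * Y by rewrite !mulrA.
  by rewrite !mulrA -(mulrA _ r ri) rri mulr1 -(mulrA _ r ri) rri mulr1
       -(mulrA _ r ri) rri mulr1 rri.
have QTc : GRing.comm Q T by rewrite /GRing.comm TQ QT.
have QsTc : GRing.comm Qs T by rewrite /GRing.comm TQs QsT.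
have VT : V * T = 1 by rewrite -(T_V T (commr_refl T)).
have sV : sa V by do !apply: saM => //; do !apply: commrM; exact: commr_refl.
have QV := T_V _ QTc; have QsV := T_V _ QsTc.
exists (Q * Qs * V), (Qs * Q * V), r, ri, d.
have PQ : Q * Qs * V * Q = Q.
  by rewrite -mulrA -QV mulrA -TQ -mulrA QV mulrA TV mul1r.
have QP : Q * (Q * Qs * V) = Q * Qs * V by rewrite !mulrA QQ.
have P'Qs : Qs * Q * V * Qs = Qs.
  by rewrite -mulrA -QsV mulrA -TQs -mulrA QsV mulrA TV mul1r.
have QsP' : Qs * (Qs * Q * V) = Qs * Q * V by rewrite !mulrA QsQs.
have QQsT : GRing.comm T (Q * Qs).
  by apply: commrM; apply: commr_sym.
have saP : sa (Q * Qs * V).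
  apply: saM => //; first by rewrite /sa adjM aQs.
  by apply/commr_sym/commrM; apply/commr_sym.
have saP' : sa (Qs * Q * V).
  apply: saM => //; first by rewrite /sa adjM aQs.
  by apply/commr_sym/commrM; apply/commr_sym.
have PT : GRing.comm (Q * Qs * V) T.
  by apply/commr_sym/commrM => //; exact: T_V.
have PQs : Q * Qs * V * Qs = Q * Qs * V.
  by rewrite -{1}saP -aQs -adjM aQs QP saP.
have PP (X Y : 'L(H)) : X * Y * V * X = X -> X * Y * V * (X * Y * V) = X * Y * V.
  by move=> XYVX; rewrite (mulrA _ (X * Y)) (mulrA _ X) XYVX.
split; last 1 first.
(* With [P = Q Qs V], the rules [P Qs = P], [P Q = Q], [Q V = V Q] and [Q P = P] reduce [P P' P] to
   [V P]. *)
- rewrite -/V (mulrA _ (Qs * Q)) (mulrA _ Qs) PQs PQ QV -[LHS]mulrA QP.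
  by [].
- split=> //; first exact: PP.
  + exact: T_r.
  + by rewrite rr.
  + by rewrite rr.
  + by rewrite rr SS -PT -mulrA VT mulr1.
  + by rewrite rr SS.
- by [].
- exact: PP.
- by [].
Qed.

End Idempotent.

(** * Evaluation of the right-hand sides by operator algebra *)

Section DataTheory.
Context {R : realType} {A : cstarAlgType R} {H : hilbertModType A}.
Context {Q P r ri d : 'L(H)} (D : idempotent_data Q P r ri d).
Implicit Types (X Y Z : 'L(H)) (h : H).
Local Notation S := (r * r).
Local Notation Si := (ri * ri).
Local Notation E := (Q - P).

(** Together with [data_EP]: relative to [P], the operator [E = Q - P] is a single off-diagonal
    block, the one called A in the definition of [m(Q)]. *)
Lemma data_PE : P * E = E.
Proof. by rewrite mulrBr (id_PQ D) (id_PP D). Qed.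

Lemma data_EP : E * P = 0.
Proof. by rewrite mulrBl (id_QP D) (id_PP D) subrr. Qed.

Lemma data_adjE : adj E = adj Q - P.
Proof. by rewrite adjB (id_saP D). Qed.

Lemma data_adjEP : adj E * P = adj E.
Proof. by rewrite -[X in _ * X](id_saP D) -adjM data_PE. Qed.

Lemma data_PadjE : P * adj E = 0.
Proof. by rewrite -{1}(id_saP D) -adjM data_EP adj0. Qed.

Lemma data_adjQP : adj Q * P = adj Q.
Proof. by rewrite -[X in _ * X](id_saP D) -adjM (id_PQ D). Qed.

Lemma data_PadjQ : P * adj Q = P.
Proof. by rewrite -{1}(id_saP D) -adjM (id_QP D) (id_saP D). Qed.

Lemma data_EE : E * adj E = Q * adj Q - P.
Proof.
by rewrite data_adjE mulrBr !mulrBl (id_QP D) data_PadjQ (id_PP D); abel.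
Qed.

Lemma data_SiS : Si * S = 1.
Proof. by rewrite -mulrA (mulrA ri r) (id_rir D) mul1r (id_rir D). Qed.

Lemma data_SSi : S * Si = 1.
Proof. by rewrite -mulrA (mulrA r ri) (id_rri D) mul1r (id_rri D). Qed.

Lemma data_comm X : GRing.comm X r -> [/\ GRing.comm X S, GRing.comm X ri,
  GRing.comm X Si & GRing.comm X d].
Proof.
move=> Xr; have XS : GRing.comm X S := commrM Xr Xr.
have Xri := comm_inv (id_rir D) (id_rri D) Xr.
split=> //; first exact: commrM.
apply: comm_inv (id_d D) (id_d' D) _; apply: commrD => //; exact: commr1.
Qed.

Lemma data_PS : GRing.comm P S. Proof. by have [] := data_comm (id_Pr D). Qed.
Lemma data_Pri : GRing.comm P ri. Proof. by have [] := data_comm (id_Pr D). Qed.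
Lemma data_PSi : GRing.comm P Si. Proof. by have [] := data_comm (id_Pr D). Qed.
Lemma data_Pd : GRing.comm P d. Proof. by have [] := data_comm (id_Pr D). Qed.
Lemma data_Sid : GRing.comm Si d.
Proof.
by apply: comm_inv (id_d D) (id_d' D) _; apply: commrD; rewrite /GRing.comm
  ?data_SiS ?data_SSi ?mulr1 ?mul1r.
Qed.

Lemma data_sari : sa ri.
Proof. exact: sa_inv (id_rir D) (id_rri D) (id_sar D). Qed.

Lemma data_sqrt : sqrtL (S * S * P) = S * P.
Proof.
exact: sqrtL_projection (id_sar D) (id_bic D) (id_saP D) (id_PP D) (id_Pr D).
Qed.

(** [sqrtL_projection] with [ri] in place of [r]: what commutes with [r^-4] commutes with [r^4],
    hence with [r^2] and its inverse. *)
Lemma data_sqrt_inv : sqrtL (Si * Si * P) = Si * P.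
Proof.
have SSV : S * S * (Si * Si) = 1.
  by rewrite -mulrA (mulrA S Si) data_SSi mul1r data_SSi.
have VSS : Si * Si * (S * S) = 1.
  by rewrite -mulrA (mulrA Si S) data_SiS mul1r data_SiS.
apply: sqrtL_projection data_sari _ (id_saP D) (id_PP D) data_Pri => Z ZV.
exact: comm_inv data_SiS data_SSi (id_bic D (comm_inv SSV VSS ZV)).
Qed.

Lemma data_absL : absL (adj Q) = S * P.
Proof. by rewrite /absL adjK -mulLE (id_QQ D) data_sqrt. Qed.

Lemma data_projL : projL (rangeL Q) = P.
Proof.
apply: projL_eq (id_PP D) (id_saP D) _ => /=.
apply/seteqP; split => [_ [h _ <-]|_ [h _ <-]].
  by exists (P h) => //; rewrite -[RHS]/(P h) -{2}(id_QP D).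
by exists (Q h) => //; rewrite -{2}(id_PQ D).
Qed.

Lemma data_moore_penrose : moore_penrose (S * P) (Si * P).
Proof.
have PE1 : S * P * (Si * P) = P.
  by rewrite -mulrA (mulrA P) data_PSi -(mulrA Si P) (id_PP D) mulrA data_SSi mul1r.
have PE2 : Si * P * (S * P) = P.
  by rewrite -mulrA (mulrA P) data_PS -(mulrA S P) (id_PP D) mulrA data_SiS mul1r.
split; rewrite -!mulLE ?PE1 ?PE2 ?(id_saP D)//.
  by rewrite mulrA data_PS -mulrA (id_PP D).
by rewrite mulrA data_PSi -mulrA (id_PP D).
Qed.

(** [S P + 1 = (S + 1) P + (1 - P)] is diagonal for the decomposition along [P] and is inverted
    block by block. *)
Lemma data_invL : invL (S * P + 1) = d * P + (1 - P).
Proof.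
have PP0 : P * (1 - P) = 0 by rewrite mulrBr mulr1 (id_PP D) subrr.
have PP0' : (1 - P) * P = 0 by rewrite mulrBl mul1r (id_PP D) subrr.
have SE : S * P + 1 = (S + 1) * P + (1 - P) by rewrite mulrDl mul1r; abel.
have NN : (1 - P) * (1 - P) = 1 - P.
  by rewrite mulrBr mulr1 PP0' subr0.
have mixed X Y : GRing.comm P X -> GRing.comm P Y -> X * Y = 1 ->
    (X * P + (1 - P)) * (Y * P + (1 - P)) = 1.
  move=> PX PY XY; have : P + (1 - P) = 1 by abel.
  move: (1 - P) PP0 PP0' NN => N PN NP NN PN1; rewrite mulrDl !mulrDr NN.
  have -> : X * P * (Y * P) = P.
    by rewrite -mulrA (mulrA P) PY -(mulrA Y) (id_PP D) mulrA XY mul1r.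
  by rewrite -PY (mulrA N) NP mul0r -(mulrA X) PN mulr0 addr0 add0r.
have PS1 : GRing.comm P (S + 1).
  by apply: commrD; [exact: data_PS|exact: commr1].
apply: invL_eq => h; rewrite SE.
  exact: (congr1 (fun T : 'L(H) => T h) (mixed _ _ data_Pd PS1 (id_d D))).
exact: (congr1 (fun T : 'L(H) => T h) (mixed _ _ PS1 data_Pd (id_d' D))).
Qed.

(** The outer factors are [(S + 1) P + adj E] and [(S + 1) P + E], the middle ones multiply to
    [S^-1 d P], and [d] cancels [S + 1]. The result lists the blocks of the matrix defining [m(Q)],
    without the factor 1/2; the upper left one is [P + Si * P]. *)
Lemma data_formula :
  (S * P + adj Q) * (Si * P) * (d * P + (1 - P)) * (S * P + Q) =
  P + Si * P + Si * E + adj E * Si + adj E * (d * Si) * E.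
Proof.
have -> : S * P + adj Q = (S + 1) * P + adj E.
  by rewrite data_adjE mulrDl mul1r; abel.
rewrite -mulrA -(mulrA _ (Si * P)).
have -> : Si * P * ((d * P + (1 - P)) * (S * P + Q)) = Si * P + d * Si * E.
  have -> : S * P + Q = (S + 1) * P + E by rewrite mulrDl mul1r; abel.
  have -> : Si * P * ((d * P + (1 - P)) * ((S + 1) * P + E)) =
      Si * (P * (d * P + (1 - P))) * ((S + 1) * P + E) by rewrite !mulrA.
  have -> : P * (d * P + (1 - P)) = P * d.
    rewrite mulrDr mulrBr mulr1 (id_PP D) subrr addr0.
    by rewrite data_Pd mulrA data_Pd -mulrA (id_PP D).
  rewrite mulrDr; congr (_ + _).
    have -> : Si * (P * d) * ((S + 1) * P) = Si * P * (d * (S + 1)) * P.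
      by rewrite !mulrA.
    by rewrite (id_d D) mulr1 -mulrA (id_PP D).
  by rewrite data_Pd (mulrA Si) -(mulrA _ P) data_PE data_Sid.
rewrite mulrDl (mulrDr _ (Si * P)) (mulrDr (adj E) (Si * P)).
have -> : (S + 1) * P * (Si * P) = P + Si * P.
  rewrite -mulrA (mulrA P) data_PSi -(mulrA Si) (id_PP D) mulrDl mul1r.
  by rewrite mulrA data_SSi mul1r.
have -> : (S + 1) * P * (d * Si * E) = Si * E.
  have -> : (S + 1) * P * (d * Si * E) = (S + 1) * (P * d) * Si * E.
    by rewrite !mulrA.
  rewrite data_Pd (mulrA (S + 1)) (id_d' D) mul1r data_PSi -(mulrA Si).
  by rewrite data_PE.
have -> : adj E * (Si * P) = adj E * Si.
  by rewrite -data_PSi mulrA data_adjEP.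
by rewrite (mulrA (adj E) (d * Si)); abel.
Qed.

End DataTheory.

(** * Computation of the block matrix of [m(Q)] *)

Section Matched.
Context {R : realType} {A : cstarAlgType R} {H : hilbertModType A}.
Context {Q P r ri d : 'L(H)} (D : idempotent_data Q P r ri d).
Implicit Types (X Y Z : 'L(H)) (h : H).
Local Notation S := (r * r).
Local Notation Si := (ri * ri).
Local Notation E := (Q - P).
Local Notation M := (rangeL Q).
Local Notation N := (nullL (adj Q)).

Lemma submod_inner_inj (L : submod H) (x y : L) :
  (forall z : L, inner z x = inner z y :> A) -> x = y.
Proof.
move=> xy; apply/eqP; rewrite -subr_eq0; apply/eqP/val_inj/inner_eq0.
by rewrite [LHS](_ : _ = inner (x - y) (x - y))// innerDr innerNr xy subrr.
Qed.

Lemma mem_rangeL h : P h = h -> h \in submod_pred M.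
Proof.
move=> Ph; rewrite unfold_in inE /=; exists (P h) => //.
by rewrite -[LHS]/((Q * P) h) (id_QP D).
Qed.

Lemma mem_nullL h : P h = 0 -> h \in submod_pred N.
Proof.
move=> Ph; rewrite unfold_in inE /= -(data_adjQP D).
by rewrite mulLE /= Ph adjop0.
Qed.

Lemma rangeL_val (m : M) : P (submod_val m) = submod_val m.
Proof.
case: m => m /=; rewrite unfold_in inE /= => -[h _ <-].
by rewrite -[LHS]/((P * Q) h) (id_PQ D).
Qed.

Lemma nullL_val (n : N) : P (submod_val n) = 0.
Proof.
case: n => n /=; rewrite unfold_in inE /= => Qn.
by rewrite -(data_PadjQ D) mulLE /= Qn adjop0.
Qed.

Definition toM h : M :=
  SubmodElt (mem_rangeL (congr1 (fun T : 'L(H) => T h) (id_PP D))).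

Fact toN_subproof h : P ((1 - P) h) = 0.
Proof.
rewrite -[LHS]/((P * (1 - P)) h).
by rewrite mulrBr mulr1 (id_PP D) subrr.
Qed.
Definition toN h : N := SubmodElt (mem_nullL (toN_subproof h)).

Lemma inner_toM (m : M) h : inner m (toM h) = inner (submod_val m) h :> A.
Proof.
by rewrite -[LHS]/(inner (submod_val m) (P h)) inner_adjl (id_saP D) rangeL_val.
Qed.

Lemma inner_toN (n : N) h : inner n (toN h) = inner (submod_val n) h :> A.
Proof.
rewrite -[LHS]/(inner (submod_val n) ((1 - P) h)) inner_adjl adjB adj1 (id_saP D).
by rewrite /= nullL_val subr0.
Qed.

Lemma inner_toMl (m : M) h : inner (toM h) m = inner h (submod_val m) :> A.
Proof. by rewrite -inner_star inner_toM inner_star. Qed.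

Lemma inner_toNl (n : N) h : inner (toN h) n = inner h (submod_val n) :> A.
Proof. by rewrite -inner_star inner_toN inner_star. Qed.

Lemma toM_val (m : M) : toM (submod_val m) = m.
Proof. by apply: val_inj; rewrite /= rangeL_val. Qed.

Fact compress_subproof X :
  exists T, @adjoint_of _ _ M M (fun m => toM (X (submod_val m))) T.
Proof.
exists (fun m => toM (adj X (submod_val m))) => m m'.
by rewrite inner_toMl inner_toM inner_adj.
Qed.
(** Projecting back with [toM] makes this adjointable for every [X]; it is used for [X] commuting
    with [P], where it is a restriction. *)
Definition compress X : 'L(M) := AdjOp (compress_subproof X).

Lemma compressE X (m : M) : GRing.comm P X ->
  submod_val (compress X m) = X (submod_val m).
Proof.
move=> PX; rewrite -[LHS]/((P * X) (submod_val m)) PX.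
by rewrite mulLE /= rangeL_val.
Qed.

(** [the_op] defaults to 0, so a witness is exhibited: the coordinate map, whose adjoint adds the
    two components. *)
Lemma matchedU_E h : matchedU Q h = (toM h, toN h).
Proof.
have UP : exists T, @adjoint_of _ _ H (dsum M N) (fun h => (toM h, toN h)) T.
  exists (fun z => submod_val z.1 + submod_val z.2) => x z.
  by rewrite innerDr -inner_toMl -inner_toNl.
have Uin : [set U : 'L(H, dsum M N) | forall h,
    submod_val (U h).1 = projL (rangeL Q) h /\
    submod_val (U h).2 = (idL - projL (rangeL Q)) h] (AdjOp UP).
  by move=> k; rewrite (data_projL D).
have [] : submod_val (matchedU Q h).1 = projL (rangeL Q) h /\
    submod_val (matchedU Q h).2 = (idL - projL (rangeL Q)) h.
  exact: (@xgetPex _ 0 _ (ex_intro _ _ Uin) h).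
rewrite (data_projL D); case: (matchedU Q h) => m n mE nE.
by congr pair; apply: val_inj; [rewrite [LHS]mE|rewrite [LHS]nE].
Qed.

Lemma adj_matchedU (z : dsum M N) :
  adj (matchedU Q) z = submod_val z.1 + submod_val z.2.
Proof.
apply: inner_inj => h; rewrite -[LHS]inner_star -[RHS]inner_star.
rewrite -adjP matchedU_E innerDr -inner_toMl -inner_toNl.
by [].
Qed.

Lemma data_EN (n : N) : P (E (submod_val n)) = E (submod_val n).
Proof. by rewrite -[LHS]/((P * E) _) (data_PE D). Qed.

Lemma data_adjEM (m : M) : P (adj E (submod_val m)) = 0.
Proof. by rewrite -[LHS]/((P * adj E) _) (data_PadjE D). Qed.

Lemma matchedA_E (n : N) : submod_val (matchedA Q n) = E (submod_val n).
Proof.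
pose f (n : N) : M := SubmodElt (mem_rangeL (data_EN n)).
have fP : exists T, adjoint_of f T.
  exists (fun m => SubmodElt (mem_nullL (data_adjEM m))) => x m.
  exact: inner_adj.
have fin : [set S : 'L(N, M) | forall x : N,
    submod_val (S x) = (Q - projL (rangeL Q)) (submod_val x)] (AdjOp fP).
  by move=> k; rewrite (data_projL D).
rewrite -[P in RHS](data_projL D).
exact: (@xgetPex _ 0 _ (ex_intro _ _ fin) n).
Qed.

Lemma adj_matchedA_E (m : M) :
  submod_val (adj (matchedA Q) m) = adj E (submod_val m).
Proof.
have -> : adj (matchedA Q) m = SubmodElt (mem_nullL (data_adjEM m)).
  apply: submod_inner_inj => n; rewrite -adjP.
  rewrite -[LHS]/(inner (submod_val (matchedA Q n)) (submod_val m)).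
  by rewrite matchedA_E inner_adj.
by [].
Qed.

(** [E adj E = Q adj Q - P], and [P] is the identity on the range of [Q], so [Q adj Q = S^2 P]
    remains. *)
Lemma matchedAA_E (m : M) :
  submod_val ((matchedA Q \oL adj (matchedA Q) + idL) m) =
  (S * S) (submod_val m).
Proof.
rewrite /= matchedA_E adj_matchedA_E -[E (adj E _)]/((E * adj E) _).
rewrite (data_EE D) (id_QQ D) -[X in _ + X]rangeL_val.
rewrite -[LHS]/((S * S * P - P + P) _) subrK.
by rewrite mulLE /= rangeL_val.
Qed.

(** Uniqueness of square roots is available on [H], so a positive root [T] on the range of [Q] is
    extended by 0 to [L], for which [projection_sqrt_uniq] gives [L = S P]. *)
Lemma matchedB_E : matchedB Q = compress S.
Proof.
have PS := data_PS D; have PSS : GRing.comm P (S * S) by exact: commrM.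
apply: the_op_eq => [|T [pT TT]].
  split=> [m|].
    rewrite -[inner _ _]/(inner (submod_val m) (submod_val (compress S m))).
    by rewrite compressE//; exact: (sqr_positive (id_sar D)).
  apply: adjop_ext => m; apply: val_inj; rewrite [RHS]matchedAA_E.
  by rewrite -[LHS]/(submod_val (compress S (compress S m))) !compressE.
have [T' TT'] := adjopP T.
have LP : exists U, @adjoint_of _ _ H H (fun h => submod_val (T (toM h))) U.
  exists (fun h => submod_val (T' (toM h))) => x y.
  by rewrite -inner_toM -inner_toMl TT'.
pose L : 'L(H) := AdjOp LP.
have LSP : L = S * P.
  apply: projection_sqrt_uniq (id_sar D) (id_bic D) (id_saP D) (id_PP D)
    (id_Pr D) _ _.
    by move=> h; rewrite /= -inner_toMl.
  apply: adjop_ext => h; rewrite mulLE /= toM_val.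
  have := congr1 (fun U : 'L(M) => submod_val (U (toM h))) TT.
  rewrite matchedAA_E /= => ->.
  by [].
apply: adjop_ext => m; apply: val_inj.
have := congr1 (fun U : 'L(H) => U (submod_val m)) LSP.
rewrite /= toM_val => ->.
by rewrite -[RHS]/((P * S) _) PS.
Qed.

Lemma matched_invB : invL (matchedB Q) = compress Si.
Proof.
rewrite matchedB_E; have PS := data_PS D; have PSi := data_PSi D.
apply: invL_eq => m; apply: val_inj.
  rewrite -[LHS]/(submod_val (compress Si (compress S m))) !compressE//.
  rewrite -[LHS]/((Si * S) _).
  by rewrite (data_SiS D).
rewrite -[LHS]/(submod_val (compress S (compress Si m))) !compressE//.
rewrite -[LHS]/((S * Si) _).
by rewrite (data_SSi D).
Qed.

Lemma matched_invBB :
  invL (matchedB Q \oL (matchedB Q + idL)) = compress (d * Si).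
Proof.
rewrite matchedB_E; have PS := data_PS D; have PSi := data_PSi D.
have Pd := data_Pd D; have PdSi : GRing.comm P (d * Si) by exact: commrM.
have BE (m : M) : submod_val ((compress S \oL (compress S + idL)) m) =
    (S * (S + 1)) (submod_val m).
  rewrite -[LHS]/(submod_val (compress S (compress S m + m))) compressE//.
  rewrite -[submod_val _]/(submod_val (compress S m) + submod_val m).
  by rewrite compressE.
apply: invL_eq => m; apply: val_inj.
  rewrite [LHS]compressE// BE -[LHS]/((d * Si * (S * (S + 1))) _).
  by rewrite -mulrA (mulrA Si) (data_SiS D) mul1r (id_d D).
rewrite [LHS]BE compressE// -[LHS]/((S * (S + 1) * (d * Si)) _).
by rewrite -mulrA (mulrA (S + 1)) (id_d' D) mul1r (data_SSi D).
Qed.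

Lemma matched_formula :
  adj (matchedU Q) \oL (2^-1 *: matched_block Q) \oL matchedU Q =
  2^-1 *: (P + Si * P + Si * E + adj E * Si + adj E * (d * Si) * E).
Proof.
have PS := data_PS D; have PSi := data_PSi D.
have PdSi : GRing.comm P (d * Si) by exact: commrM (data_Pd D) PSi.
have E1P : E * (1 - P) = E by rewrite mulrBr mulr1 (data_EP D) subr0.
have toNE h : E (submod_val (toN h)) = E h by rewrite -[LHS]/((E * (1 - P)) h) E1P.
pose a := matchedA Q; pose b := matchedB Q.
(* [F1] to [F4] evaluate the four blocks at the coordinates of [h]; by [toNE], [E] takes the same
   value at [h] and at its second coordinate. *)
have F1 h : submod_val ((b + idL) (invL b (toM h))) = (P + Si * P) h.
  rewrite /b matched_invB matchedB_E.
  rewrite -[LHS]/(submod_val (compress S (compress Si (toM h))) +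
    submod_val (compress Si (toM h))) !compressE//.
  rewrite -[LHS]/((S * Si * P + Si * P) h).
  by rewrite (data_SSi D) mul1r.
have F2 h : submod_val (invL b (a (toN h))) = (Si * E) h.
  by rewrite /b matched_invB compressE// matchedA_E toNE.
have F3 h : submod_val (adj a (invL b (toM h))) = (adj E * Si) h.
  rewrite /b matched_invB adj_matchedA_E compressE//.
  rewrite -[LHS]/((adj E * (Si * P)) h).
  by rewrite -PSi mulrA (data_adjEP D).
have F4 h : submod_val (adj a (invL (b \oL (b + idL)) (a (toN h)))) =
    (adj E * (d * Si) * E) h.
  by rewrite /b matched_invBB adj_matchedA_E compressE// matchedA_E toNE.
apply: adjop_ext => h.
rewrite -[LHS]/(adj (matchedU Q) (2^-1 *: matched_block Q (matchedU Q h))).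
rewrite adj_matchedU matchedU_E.
rewrite -[LHS]/(2^-1 *: (submod_val ((b + idL) (invL b (toM h))) +
    submod_val (invL b (a (toN h)))) + 2^-1 *: (
  submod_val (adj a (invL b (toM h))) +
    submod_val (adj a (invL (b \oL (b + idL)) (a (toN h)))))).
by rewrite -scalerDr F1 F2 F3 F4 addrA.
Qed.

End Matched.

Theorem theorem3p4 (R : realType) (A : cstarAlgType R) (H : hilbertModType A)
    (Q : 'L(H)) (hQ : idempotentL Q) :
  [/\ moore_penrose (absL (adj Q)) (pinvL (absL (adj Q))),
      matched_proj Q =
        2^-1 *: ((absL (adj Q) + adj Q) \oL pinvL (absL (adj Q))
                  \oL invL (absL (adj Q) + idL) \oL (absL (adj Q) + Q))
    & pinvL (absL (adj Q)) =
        sqrtL (projL (rangeL Q) \oL projL (rangeL (adj Q))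
                \oL projL (rangeL Q))].
Proof.
have [P [P' [r [ri [d [D sP' P'P' [P'Qs QsP'] PP'P]]]]]] := idempotent_dataP hQ.
have P'E : projL (rangeL (adj Q)) = P'.
  apply: projL_eq P'P' sP' _; apply/seteqP; split => [_ [h _ <-]|_ [h _ <-]].
    by exists (P' h) => //; rewrite -[LHS]/((adj Q * P') h) QsP'.
  by exists (adj Q h) => //; rewrite -[LHS]/((P' * adj Q) h) P'Qs.
rewrite (data_absL D) (pinvL_eq (data_moore_penrose D)) (data_projL D) P'E.
(* The default 0 of [pinvL] is ruled out: [ri^2 P] is a Moore-Penrose inverse of [r^2 P]. *)
split; first exact: data_moore_penrose D.
  rewrite (data_invL D) -!mulLE (data_formula D).
  (* If [Q] is a projection, [m(Q)] is [Q] by definition; then [Q = P] and the right-hand side has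
     to collapse to [P]. *)
  rewrite /matched_proj; case: asboolP => [[_ sQ]|_]; last exact: matched_formula D.
  have QP : Q = P.
    by rewrite -[LHS]sQ -(id_PQ D) adjM (id_saP D) sQ (id_QP D).
  have SSP : r * r * (r * r) * P = P.
    by rewrite -(id_QQ D) sQ QP (id_PP D).
  (* [(r^2 + 1) (r^2 P - P) = r^4 P - P = 0], and [d] inverts [r^2 + 1]. *)
  have SP : r * r * P = P.
    apply/eqP; rewrite -subr_eq0 -[X in X == _]mul1r -(id_d D) -(mulrA d).
    have -> : (r * r + 1) * (r * r * P - P) = r * r * (r * r) * P - P by ncring.
    by rewrite SSP subrr mulr0.
  have SiP : ri * ri * P = P by rewrite -{1}SP mulrA (data_SiS D) mul1r.
  rewrite SiP QP subrr adj0 !mulr0 !mul0r !addr0.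
  apply: adjop_ext => h /=.
  have half (v : H) : 2^-1 *: (v + v) = v :> H.
    by rewrite -mulr2n -(@scaler_nat R[i] H 2 v) scalerA mulVf ?scale1r ?pnatr_eq0.
  by rewrite half.
by rewrite -!mulLE PP'P (data_sqrt_inv D).
Qed.
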